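(* Let $0<p\le1$. Every $w=p^+w^++p^-w^-\in H^p(D,\mathbb{B})$ has a boundary value in the sense of distributions $w_b$, and $$w_b=p^+w^+_b+p^-w^-_b,$$ where $w^\pm_b$ are the boundary values in the sense of distributions of $w^\pm$.
   Context: $D=\{z\in\mathbb{C}:|z|<1\}$, $z=x+iy$; $z^*$ denotes complex conjugation. The bicomplex numbers $\mathbb{B}$ are the elements $z_1+jz_2$ with $z_1,z_2\in\mathbb{C}$, $j^2=-1$, forming a commutative $\mathbb{C}$-algebra. Put $p^\pm=\frac12(1\pm ij)$; these are idempotents with $p^+p^-=0$ and $p^++p^-=1$. Every $w\in\mathbb{B}$ is uniquely $w=p^+w^++p^-w^-$ with $w^\pm\in\mathbb{C}$; for $\mathbb{B}$-valued functions $w^\pm$ are the component functions. The norm is $\|w\|_{\mathbb{B}}=\sqrt{(|w^+|^2+|w^-|^2)/2}$. $\bar\partial=\frac12\left(\frac{\partial}{\partial x}+j\frac{\partial}{\partial y}\right)$, equivalently $\bar\partial w=p^+\frac{\partial w^+}{\partial z}+p^-\frac{\partial w^-}{\partial z^*}$. $H^p(D,\mathbb{B})$ is the set of $f:D\to\mathbb{B}$ with $\bar\partial f=0$ and $\sup_{0<r<1}\int_0^{2\pi}\|f(re^{i\theta})\|_{\mathbb{B}}^p\,d\theta<\infty$. A function $f$ on $D$ with values in $\mathbb{C}$ or $\mathbb{B}$ has a boundary value in the sense of distributions, denoted $f_b$, if for every $\varphi\in C^\infty(\partial D)$ the limit $\langle f_b,\varphi\rangle:=\lim_{r\nearrow1}\int_0^{2\pi}f(re^{i\theta})\varphi(e^{i\theta})\,d\theta$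 exists. *)

(* Defs.v *)
From Stdlib Require Import Reals Lra.
From Coquelicot Require Import Coquelicot.
Open Scope R_scope.

(** * Bicomplex numbers; the pair [(z1, z2)] stands for [z1 + j z2] *)

Definition BC : Type := (C * C)%type.

(* [C] carries its real normed-module structure here, so that [BC] is a real
   normed module; [BCnormE] below identifies its norm with [BCnorm]. *)
Definition BC_NormedModule : NormedModule R_AbsRing :=
  prod_NormedModule R_AbsRing C_R_NormedModule C_R_NormedModule.

Definition BCinj (z : C) : BC := (z, RtoC 0).
Definition BCj : BC := (RtoC 0, RtoC 1).
Definition BCplus (w u : BC) : BC :=
  (Cplus (fst w) (fst u), Cplus (snd w) (snd u)).
Definition BCmult (w u : BC) : BC :=
  (Cminus (Cmult (fst w) (fst u)) (Cmult (snd w) (snd u)),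
   Cplus (Cmult (fst w) (snd u)) (Cmult (snd w) (fst u))).

Definition pplus : BC :=
  BCmult (BCinj (RtoC (/ 2))) (BCplus (BCinj (RtoC 1)) (BCmult (BCinj Ci) BCj)).
Definition pminus : BC :=
  BCmult (BCinj (RtoC (/ 2)))
    (BCplus (BCinj (RtoC 1)) (BCmult (BCinj (Copp Ci)) BCj)).

(* The coefficients of [w] on the idempotents: see [BC_decomp] and
   [BC_decomp_unique]. *)
Definition wplus (w : BC) : C := Cminus (fst w) (Cmult Ci (snd w)).
Definition wminus (w : BC) : C := Cplus (fst w) (Cmult Ci (snd w)).

Definition BCcomb (a b : C) : BC :=
  BCplus (BCmult pplus (BCinj a)) (BCmult pminus (BCinj b)).

Definition BCnorm (w : BC) : R :=
  sqrt ((Cmod (wplus w) ^ 2 + Cmod (wminus w) ^ 2) / 2).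

Lemma BC_eq (a b c d a' b' c' d' : R) :
  a = a' -> b = b' -> c = c' -> d = d' ->
  ((a, b), (c, d)) = ((a', b'), (c', d')) :> BC.
Proof. intros -> -> -> ->; reflexivity. Qed.

Lemma BCmultE (a b c d a' b' c' d' : R) :
  BCmult ((a, b), (c, d)) ((a', b'), (c', d')) =
  ((a * a' - b * b' - (c * c' - d * d'), a * b' + b * a' - (c * d' + d * c')),
   (a * c' - b * d' + (c * a' - d * b'), a * d' + b * c' + (c * b' + d * a'))).
Proof. reflexivity. Qed.

Lemma BCplusE (a b c d a' b' c' d' : R) :
  BCplus ((a, b), (c, d)) ((a', b'), (c', d')) =
  ((a + a', b + b'), (c + c', d + d')).
Proof. reflexivity. Qed.

Lemma wplusE (a b c d : R) : wplus ((a, b), (c, d)) = (a + d, b - c).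
Proof. apply injective_projections; simpl; ring. Qed.

Lemma wminusE (a b c d : R) : wminus ((a, b), (c, d)) = (a - d, b + c).
Proof. apply injective_projections; simpl; ring. Qed.

Lemma BCj_sq : BCmult BCj BCj = BCinj (RtoC (-1)).
Proof.
unfold BCj, BCinj, RtoC; rewrite BCmultE; apply BC_eq; ring.
Qed.

Lemma pplusE : pplus = ((/ 2, 0), (0, / 2)).
Proof.
unfold pplus, BCj, BCinj, Ci, RtoC; rewrite BCmultE, BCplusE, BCmultE.
apply BC_eq; field.
Qed.

Lemma pminusE : pminus = ((/ 2, 0), (0, - / 2)).
Proof.
unfold pminus, BCj, BCinj, Ci, RtoC, Copp; simpl fst; simpl snd.
rewrite BCmultE, BCplusE, BCmultE.
apply BC_eq; field.
Qed.

Lemma BCcombE (a b c d : R) :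
  BCcomb (a, b) (c, d) =
  (((a + c) / 2, (b + d) / 2), ((d - b) / 2, (a - c) / 2)).
Proof.
unfold BCcomb; rewrite pplusE, pminusE; unfold BCinj, RtoC.
rewrite !BCmultE, BCplusE; apply BC_eq; field.
Qed.

Lemma BC_decomp (w : BC) : w = BCcomb (wplus w) (wminus w).
Proof.
destruct w as [[a b] [c d]]; rewrite wplusE, wminusE, BCcombE.
apply BC_eq; field.
Qed.

Lemma BC_decomp_unique (a b : C) :
  wplus (BCcomb a b) = a /\ wminus (BCcomb a b) = b.
Proof.
destruct a as [a1 a2], b as [b1 b2]; rewrite BCcombE, wplusE, wminusE.
split; apply injective_projections; simpl; field.
Qed.

Lemma Cmod_sq (z : C) : Cmod z ^ 2 = fst z ^ 2 + snd z ^ 2.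
Proof. apply pow2_sqrt; nra. Qed.

Lemma BCnormE (w : BC) : BCnorm w = @norm R_AbsRing BC_NormedModule w.
Proof.
destruct w as [[x1 y1] [x2 y2]].
transitivity (sqrt (sqrt (Rabs x1 ^ 2 + Rabs y1 ^ 2) ^ 2 +
                    sqrt (Rabs x2 ^ 2 + Rabs y2 ^ 2) ^ 2)); [|reflexivity].
rewrite !pow2_abs, !pow2_sqrt by nra.
unfold BCnorm; f_equal; rewrite wplusE, wminusE, !Cmod_sq; simpl; field.
Qed.

(** * Holomorphic bicomplex functions on the unit disc *)

(* [d] is the value at [z] of [1/2 (df/dx + j df/dy)]. *)
Definition is_dbar (f : C -> BC) (z : C) (d : BC) : Prop :=
  exists fx fy : BC,
    is_derive (V := BC_NormedModule) (fun x : R => f (x, Im z)) (Re z) fx /\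
    is_derive (V := BC_NormedModule) (fun y : R => f (Re z, y)) (Im z) fy /\
    d = BCmult (BCinj (RtoC (/ 2))) (BCplus fx (BCmult BCj fy)).

(* Functions on the disc are total functions on [C] whose values off the disc
   are never used.  Differentiability is in the real (Frechet) sense; the mere
   existence of partial derivatives would allow discontinuous functions. *)
Definition dbar_holomorphic (f : C -> BC) : Prop :=
  forall z : C, Cmod z < 1 ->
    ex_filterdiff (K := R_AbsRing) (U := C_R_NormedModule)
      (V := BC_NormedModule) f (locally (T := C_R_NormedModule) z) /\
    is_dbar f z (BCinj (RtoC 0)).

(** * Hardy spaces *)

Definition expi (t : R) : C := (cos t, sin t).

(* [Rpower 0 p] is [1], hence the case distinction. *)
Definition rpow (x p : R) : R := if Rlt_dec 0 x then Rpower x p else 0.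

Definition Hardy (p : R) (f : C -> BC) : Prop :=
  dbar_holomorphic f /\
  exists M : R, forall r : R, 0 < r < 1 ->
    exists I : R,
      is_RInt (fun t : R => rpow (BCnorm (f (Cmult (RtoC r) (expi t)))) p)
        0 (2 * PI) I /\
      I <= M.

(** * Boundary values in the sense of distributions *)

(* Smooth functions on the circle, viewed as restrictions of functions on [C]:
   smoothness is that of [t |-> phi (e^{it})]. *)
Definition smooth_circle (phi : C -> C) : Prop :=
  forall (n : nat) (t : R),
    ex_derive_n (fun s : R => Re (phi (expi s))) n t /\
    ex_derive_n (fun s : R => Im (phi (expi s))) n t.

(* [fb phi] is the pairing of the distribution with [phi]; [act] is the
   multiplication by complex scalars on [V], which is only a real normed module
   because that is what [is_RInt] requires. *)
Definition is_boundary_value (V : NormedModule R_AbsRing) (act : C -> V -> V)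
    (f : C -> V) (fb : (C -> C) -> V) : Prop :=
  forall phi : C -> C, smooth_circle phi ->
    exists I : R -> V,
      (forall r : R, 0 < r < 1 ->
        is_RInt (fun t : R => act (phi (expi t)) (f (Cmult (RtoC r) (expi t))))
          0 (2 * PI) (I r)) /\
      filterlim I (at_left 1) (locally (fb phi)).

Definition is_boundary_value_C : (C -> C) -> ((C -> C) -> C) -> Prop :=
  is_boundary_value C_R_NormedModule Cmult.

Definition is_boundary_value_BC : (C -> BC) -> ((C -> C) -> BC) -> Prop :=
  is_boundary_value BC_NormedModule (fun c w => BCmult (BCinj c) w).

Lemma is_boundary_value_unique (V : NormedModule R_AbsRing)
    (act : C -> V -> V) (f : C -> V) (fb fb' : (C -> C) -> V) :
  is_boundary_value V act f fb -> is_boundary_value V act f fb' ->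
  forall phi : C -> C, smooth_circle phi -> fb phi = fb' phi.
Proof.
intros H H' phi Hphi.
destruct (H phi Hphi) as [I [HI Hl]], (H' phi Hphi) as [I' [HI' Hl']].
apply (filterlim_locally_unique (F := at_left 1) I); [exact Hl|].
apply (filterlim_ext_loc I'); [|exact Hl'].
exists (mkposreal (/ 2) ltac:(lra)); intros r Hr Hr1.
apply Rabs_def2 in Hr; simpl in Hr; unfold minus, plus, opp in Hr; simpl in Hr.
assert (Hr' : 0 < r < 1) by lra.
assert (Hp : 0 < 2 * PI) by (generalize PI_RGT_0; lra).
apply (filterlim_locally_unique _ _ _ (HI' r Hr') (HI r Hr')).
Qed.

(* Main.v *)
Require Import Defs.
From Stdlib Require Import Reals Lra ClassicalEpsilon.
From Coquelicot Require Import Coquelicot.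
Open Scope R_scope.

(** The two idempotent components decouple the problem: if [dbar w = 0] then
    [w^-] and the conjugate of [w^+] are holomorphic on the disc, and both
    inherit from [w] a bound on the circle means of order [p].  So it is enough
    to treat a holomorphic [f = g + i h] with
    [int |f(r e^{it})|^p dt <= M] for all [r < 1], and to find, for each real
    smooth [phi], the limits as [r -> 1] of the pairings
    [P_g(phi, r) = int g(r e^{it}) phi(t) dt] and [P_h(phi, r)].

    First, such an [f] grows at most polynomially: [|f(z)| <= K (1 - |z|)^{-n}]
    ([polynomial_growth]).  Cauchy's formula bounds [|f(z)|] by a multiple of
    [(r - |z|)^{-1} int |f(r e^{it})| dt] ([cauchy_estimate]).  With
    [|f| <= |f|^p T^{1-p}] on a circle where [|f| <= T], the integral is at most
    [M T^{1-p}].  For [n >= 1/p] the supremum [S] of [|f(z)| (rho - |z|)^n] over a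
    disc of radius [rho < 1] is finite and then satisfies [S <= K S^{1-p}], which
    bounds it independently of [rho].

    Second, polynomial growth suffices.  In polar coordinates the
    Cauchy-Riemann equations read [r dg/dr = dh/dt], [r dh/dr = - dg/dt], so
    integrating by parts in [t] turns the radial derivative of a pairing into
    [- 1/r] or [1/r] times the other pairing with [phi'].  If all pairings are
    [O((1 - r)^e)] with [e < -1], integrating in [r] shows that they are
    [O((1 - r)^{e+1})].  Starting from the exponent [- (n + 1/2)], where the shift
    by one half keeps logarithms away, one reaches [- 1/2]; one more
    integration then gives the Cauchy criterion at [r = 1].

    Holomorphy is real differentiability with the Cauchy-Riemann equations,
    the partial derivatives not being assumed continuous.  Both uses of it
    (the radial variation of pairings and Cauchy's formula) therefore rest on
    a form of Goursat's theorem, [divergence_theorem], for vector fields that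
    are differentiable with continuous divergence; it is proved by
    repeated bisection of a rectangle ([rect_bisection]). *)

(** * Additive functions of rectangles *)

Lemma nested_intervals (a b : nat -> R) :
  (forall n, a n <= a (S n)) -> (forall n, b (S n) <= b n) ->
  (forall n, a n <= b n) ->
  exists x, forall n, a n <= x <= b n.
Proof.
intros Ha Hb Hab.
assert (Ham : forall n k, a n <= a (n + k)%nat).
{ intros n k; induction k as [|k IH]; [rewrite Nat.add_0_r; lra|].
  rewrite Nat.add_succ_r; generalize (Ha (n + k)%nat); lra. }
assert (Hbm : forall n k, b (n + k)%nat <= b n).
{ intros n k; induction k as [|k IH]; [rewrite Nat.add_0_r; lra|].
  rewrite Nat.add_succ_r; generalize (Hb (n + k)%nat); lra. }
assert (Hall : forall n m, a n <= b m).
{ intros n m.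
  apply Rle_trans with (a (n + m)%nat); [apply Ham|].
  apply Rle_trans with (b (n + m)%nat); [apply Hab|].
  rewrite Nat.add_comm; apply Hbm. }
destruct (completeness (fun y => exists n, y = a n)) as [x [Hx1 Hx2]].
- exists (b 0%nat); intros y [n ->]; apply Hall.
- exists (a 0%nat); now exists 0%nat.
- exists x; intros n; split.
  + apply Hx1; now exists n.
  + apply Hx2; intros y [m ->]; apply Hall.
Qed.

Record box := Box { bx0 : R; bx1 : R; by0 : R; by1 : R }.

(** When [J] is additive, one of the two halves carries at least half of
    [|J|]; it is the one kept. *)
Definition halve_x (J : R -> R -> R -> R -> R) (Q : box) : box :=
  let (a, b, c, d) := Q in
  let m := (a + b) / 2 in
  if Rle_dec (Rabs (J a b c d) / 2) (Rabs (J a m c d))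
  then Box a m c d else Box m b c d.

Definition halve_y (J : R -> R -> R -> R -> R) (Q : box) : box :=
  let (a, b, c, d) := Q in
  let m := (c + d) / 2 in
  if Rle_dec (Rabs (J a b c d) / 2) (Rabs (J a b c m))
  then Box a b c m else Box a b m d.

Lemma half_of_sum (x y z : R) :
  x = y + z -> ~ Rabs x / 2 <= Rabs y -> Rabs x / 2 <= Rabs z.
Proof.
intros -> H; generalize (Rabs_triang y z); lra.
Qed.

Lemma halve_xE (J : R -> R -> R -> R -> R) (a b c d : R) :
  let m := (a + b) / 2 in
  J a b c d = J a m c d + J m b c d ->
  exists e f, halve_x J (Box a b c d) = Box e f c d /\
    ((e = a /\ f = m) \/ (e = m /\ f = b)) /\
    Rabs (J a b c d) / 2 <= Rabs (J e f c d).
Proof.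
intros m H; unfold halve_x; fold m.
destruct (Rle_dec (Rabs (J a b c d) / 2) (Rabs (J a m c d))) as [h|h].
- exists a, m; tauto.
- exists m, b; generalize (half_of_sum _ _ _ H h); tauto.
Qed.

Lemma halve_yE (J : R -> R -> R -> R -> R) (a b c d : R) :
  let m := (c + d) / 2 in
  J a b c d = J a b c m + J a b m d ->
  exists e f, halve_y J (Box a b c d) = Box a b e f /\
    ((e = c /\ f = m) \/ (e = m /\ f = d)) /\
    Rabs (J a b c d) / 2 <= Rabs (J a b e f).
Proof.
intros m H; unfold halve_y; fold m.
destruct (Rle_dec (Rabs (J a b c d) / 2) (Rabs (J a b c m))) as [h|h].
- exists c, m; tauto.
- exists m, d; generalize (half_of_sum _ _ _ H h); tauto.
Qed.

(** Goursat's argument.  If [J] did not vanish, four-fold subdivision would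
    give nested rectangles, of side [2^{-n}] times the original ones, on
    which [|J|] is at least [4^{-n}] times its initial value; at their common
    point this contradicts the bound by [eps] times the square of the size. *)
Lemma rect_bisection (J : R -> R -> R -> R -> R) (a b c d : R) :
  a <= b -> c <= d ->
  (forall a' m b' c' d', a <= a' <= m -> m <= b' <= b -> c <= c' <= d' -> d' <= d ->
    J a' b' c' d' = J a' m c' d' + J m b' c' d') ->
  (forall a' b' c' m d', a <= a' <= b' -> b' <= b -> c <= c' <= m -> m <= d' <= d ->
    J a' b' c' d' = J a' b' c' m + J a' b' m d') ->
  (forall x y eps, a <= x <= b -> c <= y <= d -> 0 < eps ->
    exists delta, 0 < delta /\
    forall a' b' c' d', a <= a' <= x -> x <= b' <= b -> c <= c' <= y -> y <= d' <= d ->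
      b' - a' < delta -> d' - c' < delta ->
      Rabs (J a' b' c' d') <= eps * ((b' - a') + (d' - c')) ^ 2) ->
  J a b c d = 0.
Proof.
intros Hab Hcd Hx Hy Hloc.
destruct (Req_dec (J a b c d) 0) as [|HJ]; [assumption|exfalso].
apply Rabs_pos_lt in HJ; set (K := Rabs (J a b c d)) in HJ.
set (Q := fun n => Nat.iter n (fun P => halve_y J (halve_x J P)) (Box a b c d)).
assert (HQ : forall n,
  (a <= bx0 (Q n) <= bx1 (Q n) /\ bx1 (Q n) <= b /\
   c <= by0 (Q n) <= by1 (Q n) /\ by1 (Q n) <= d) /\
  bx1 (Q n) - bx0 (Q n) = (b - a) * (/ 2) ^ n /\
  by1 (Q n) - by0 (Q n) = (d - c) * (/ 2) ^ n /\
  K * (/ 4) ^ n <= Rabs (J (bx0 (Q n)) (bx1 (Q n)) (by0 (Q n)) (by1 (Q n))) /\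
  (bx0 (Q n) <= bx0 (Q (S n)) /\ bx1 (Q (S n)) <= bx1 (Q n) /\
   by0 (Q n) <= by0 (Q (S n)) /\ by1 (Q (S n)) <= by1 (Q n))).
{ assert (Hstep : forall P k, 
    a <= bx0 P <= bx1 P -> bx1 P <= b -> c <= by0 P <= by1 P -> by1 P <= d ->
    k <= Rabs (J (bx0 P) (bx1 P) (by0 P) (by1 P)) ->
    let P' := halve_y J (halve_x J P) in
    (bx0 P <= bx0 P' <= bx1 P' /\ bx1 P' <= bx1 P /\
     by0 P <= by0 P' <= by1 P' /\ by1 P' <= by1 P) /\
    bx1 P' - bx0 P' = (bx1 P - bx0 P) / 2 /\
    by1 P' - by0 P' = (by1 P - by0 P) / 2 /\
    k / 4 <= Rabs (J (bx0 P') (bx1 P') (by0 P') (by1 P'))).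
  { intros [a0 b0 c0 d0] k; cbn [bx0 bx1 by0 by1]; intros Ha Hb Hc Hd Hk.
    destruct (halve_xE J a0 b0 c0 d0) as [e [f [-> [Hef HJx]]]].
    { apply Hx; lra. }
    destruct (halve_yE J e f c0 d0) as [g [h [-> [Hgh HJy]]]].
    { apply Hy; lra. }
    simpl; repeat split; lra. }
  induction n as [|n IH].
  - assert (HK : K <= Rabs (J a b c d)) by (unfold K; lra).
    destruct (Hstep (Box a b c d) K) as [H _]; try (cbn [bx0 bx1 by0 by1]; lra).
    change (Box a b c d) with (Q 0%nat) in H.
    change (halve_y J (halve_x J (Q 0%nat))) with (Q 1%nat) in H.
    change (K * (/ 4) ^ 0 <= Rabs (J (bx0 (Q 0%nat)) (bx1 (Q 0%nat)) (by0 (Q 0%nat)) (by1 (Q 0%nat))))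
      with (K * 1 <= Rabs (J a b c d)).
    change (bx0 (Q 0%nat)) with a in *; change (bx1 (Q 0%nat)) with b in *.
    change (by0 (Q 0%nat)) with c in *; change (by1 (Q 0%nat)) with d in *.
    rewrite !pow_O; repeat split; lra.
  - destruct IH as [IH1 [IH2 [IH3 [IH4 IH5]]]].
    destruct (Hstep (Q n) (K * (/ 4) ^ n)) as [H1 [H2 [H3 H4]]]; try lra.
    change (halve_y J (halve_x J (Q n))) with (Q (S n)) in H1, H2, H3, H4.
    assert (H5 := Hstep (Q (S n)) (K * (/ 4) ^ n / 4)).
    change (halve_y J (halve_x J (Q (S n)))) with (Q (S (S n))) in H5.
    destruct H5 as [H5 _]; try lra.
    simpl pow; repeat split; lra. }
destruct (nested_intervals (fun n => bx0 (Q n)) (fun n => bx1 (Q n))) as [x Hxn];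
  try (intros n; apply HQ).
destruct (nested_intervals (fun n => by0 (Q n)) (fun n => by1 (Q n))) as [y Hyn];
  try (intros n; apply HQ).
set (s := (b - a) + (d - c)).
assert (Hs : 0 <= s) by (unfold s; lra).
(* With this [eps] the local bound is less than [K / 4^n] on the [n]-th rectangle. *)
set (eps := K / (2 * (s ^ 2 + 1))).
assert (Heps : 0 < eps) by (apply Rdiv_lt_0_compat; nra).
destruct (Hloc x y eps) as [delta [Hdelta Hd]].
{ generalize (Hxn 0%nat); simpl; lra. }
{ generalize (Hyn 0%nat); simpl; lra. }
{ exact Heps. }
destruct (pow_lt_1_zero (/ 2) ltac:(rewrite Rabs_pos_eq; lra) (delta / (s + 1))
  ltac:(apply Rdiv_lt_0_compat; lra)) as [n Hn].
specialize (Hn n (le_n n)).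
assert (Hp : 0 < (/ 2) ^ n) by (apply pow_lt; lra).
rewrite Rabs_pos_eq in Hn by lra.
assert (Hn' : (s + 1) * (/ 2) ^ n < delta).
{ apply (Rmult_lt_compat_l (s + 1)) in Hn; [|lra].
  replace ((s + 1) * (delta / (s + 1))) with delta in Hn by (field; lra); exact Hn. }
destruct (HQ n) as [H1 [H2 [H3 [H4 _]]]].
specialize (Hd (bx0 (Q n)) (bx1 (Q n)) (by0 (Q n)) (by1 (Q n))).
assert (Hbound := Rle_trans _ _ _ H4 (Hd ltac:(split; [lra|apply Hxn])
  ltac:(split; [apply Hxn|lra]) ltac:(split; [lra|apply Hyn])
  ltac:(split; [apply Hyn|lra]) ltac:(rewrite H2; unfold s in *; nra)
  ltac:(rewrite H3; unfold s in *; nra))).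
rewrite H2, H3, <- Rmult_plus_distr_r in Hbound; fold s in Hbound.
rewrite Rpow_mult_distr, <- pow_mult, Nat.mul_comm, pow_mult in Hbound.
replace ((/ 2) ^ 2) with (/ 4) in Hbound by field.
assert (Hq : 0 < (/ 4) ^ n) by (apply pow_lt; lra).
rewrite <- Rmult_assoc in Hbound.
apply Rmult_le_reg_r in Hbound; [|exact Hq].
assert (He : eps * (2 * (s ^ 2 + 1)) = K) by (unfold eps; field; nra).
nra.
Qed.

(** * The divergence theorem for differentiable vector fields *)

Lemma RInt_near_const (f : R -> R) (a b k M : R) :
  a <= b -> ex_RInt f a b -> (forall x, a <= x <= b -> Rabs (f x - k) <= M) ->
  Rabs (RInt f a b - k * (b - a)) <= M * (b - a).
Proof.
intros Hab Hf HM.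
assert (Hk : ex_RInt (fun _ : R => k) a b) by apply ex_RInt_const.
assert (E : RInt (fun x => f x - k) a b = RInt f a b - k * (b - a)).
{ rewrite (RInt_minus f (fun _ => k)) by assumption.
  rewrite RInt_const; unfold minus, plus, opp, scal; simpl; unfold mult; simpl; ring. }
rewrite <- E, Rmult_comm.
apply abs_RInt_le_const; [assumption| |assumption].
now apply (ex_RInt_minus (V := R_NormedModule) f (fun _ => k)).
Qed.

Lemma continuity_2d_pt_slice1 (f : R -> R -> R) (x y : R) :
  continuity_2d_pt f x y -> continuous (fun u => f u y) x.
Proof.
intros H; apply continuity_pt_filterlim, continuity_pt_locally.
intros eps; destruct (H eps) as [delta Hd].
exists delta; intros z Hz; apply Hd; [exact Hz|].
rewrite Rminus_diag, Rabs_R0; apply cond_pos.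
Qed.

Lemma continuity_2d_pt_slice2 (f : R -> R -> R) (x y : R) :
  continuity_2d_pt f x y -> continuous (fun v => f x v) y.
Proof.
intros H; apply continuity_pt_filterlim, continuity_pt_locally.
intros eps; destruct (H eps) as [delta Hd].
exists delta; intros z Hz; apply Hd; [|exact Hz].
rewrite Rminus_diag, Rabs_R0; apply cond_pos.
Qed.

Lemma ex_RInt_slice (f : R -> R -> R) (x c d : R) :
  (forall t, continuity_2d_pt f x t) -> ex_RInt (f x) c d.
Proof.
intros H; apply (ex_RInt_continuous (V := R_CompleteNormedModule)).
intros t _; apply continuity_2d_pt_slice2, H.
Qed.

(** Uniform continuity of [f] near the compact segment [{x} x [c, d]]. *)
Lemma continuous_RInt_param (f : R -> R -> R) (x c d : R) :
  c <= d -> locally x (fun x' => forall t, continuity_2d_pt f x' t) ->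
  continuous (fun x' => RInt (f x') c d) x.
Proof.
intros Hcd Hf; apply continuity_pt_filterlim, continuity_pt_locally.
intros eps.
assert (He : 0 < eps / (2 * (d - c + 1))).
{ apply Rdiv_lt_0_compat; [apply cond_pos|lra]. }
destruct (uniform_continuity_2d_1d' f c d x
  (fun t _ => locally_singleton _ _ Hf t) (mkposreal _ He)) as [delta Hd].
assert (Hx : ex_RInt (f x) c d).
{ apply ex_RInt_slice, (locally_singleton _ _ Hf). }
destruct Hf as [eta Hf].
exists (mkposreal (Rmin delta eta) ltac:(apply Rmin_pos; apply cond_pos)).
intros z Hz; change (Rabs (z - x) < Rmin delta eta) in Hz.
assert (Hz1 := Rlt_le_trans _ _ _ Hz (Rmin_l _ _)).
assert (Hz2 := Rlt_le_trans _ _ _ Hz (Rmin_r _ _)).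
assert (Hfz : ex_RInt (f z) c d) by (apply ex_RInt_slice, Hf, Hz2).
assert (E : RInt (fun t => f z t - f x t) c d = RInt (f z) c d - RInt (f x) c d).
{ now apply (RInt_minus (V := R_CompleteNormedModule) (f z) (f x)). }
rewrite <- E.
apply Rabs_def2 in Hz1.
apply Rle_lt_trans with ((d - c) * (eps / (2 * (d - c + 1)))).
- apply abs_RInt_le_const; [assumption| |].
  + now apply (ex_RInt_minus (V := R_NormedModule) (f z) (f x)).
  + intros t Ht; apply Rlt_le.
    apply (Hd t x t z Ht ltac:(generalize (cond_pos delta); lra) Ht ltac:(lra)).
    rewrite Rminus_diag, Rabs_R0; apply cond_pos.
- assert (E' : eps / (2 * (d - c + 1)) * (2 * (d - c + 1)) = eps) by (field; lra).
  generalize (cond_pos eps); nra.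
Qed.

(** The divergence is a separate function [q] because it is only [q] that is
    required to be continuous: the four partial derivatives are not. *)
Definition divergence_on (u v q : R -> R -> R) (a0 b0 : R) : Prop :=
  forall x y, a0 < x < b0 -> continuity_2d_pt q x y /\
  exists ux uy vx vy,
  differentiable_pt_lim u x y ux uy /\ differentiable_pt_lim v x y vx vy /\
  q x y = ux + vy.

Definition continuous_strip (f : R -> R -> R) (a0 b0 : R) : Prop :=
  forall x y, a0 < x < b0 -> continuity_2d_pt f x y.

Lemma divergence_on_continuous (u v q : R -> R -> R) (a0 b0 : R) :
  divergence_on u v q a0 b0 ->
  continuous_strip u a0 b0 /\ continuous_strip v a0 b0 /\ continuous_strip q a0 b0.
Proof.
intros H; repeat split; intros x y Hx;
  destruct (H x y Hx) as [Hq [ux [uy [vx [vy [Du [Dv _]]]]]]];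
  [| |exact Hq]; apply differentiable_continuity_pt.
- now exists ux, uy.
- now exists vx, vy.
Qed.

Lemma ex_RInt_row (f : R -> R -> R) (a0 b0 x c d : R) :
  continuous_strip f a0 b0 -> a0 < x < b0 -> ex_RInt (f x) c d.
Proof. intros Hf Hx; apply ex_RInt_slice; intros t; now apply Hf. Qed.

Lemma ex_RInt_col (f : R -> R -> R) (a0 b0 a b y : R) :
  continuous_strip f a0 b0 -> a0 < a -> a <= b -> b < b0 ->
  ex_RInt (fun x => f x y) a b.
Proof.
intros Hf Ha Hab Hb; apply (ex_RInt_continuous (V := R_CompleteNormedModule)).
intros x; rewrite Rmin_left, Rmax_right by lra; intros Hx.
apply continuity_2d_pt_slice1, Hf; lra.
Qed.

Lemma continuous_strip_RInt (f : R -> R -> R) (a0 b0 x c d : R) :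
  continuous_strip f a0 b0 -> c <= d -> a0 < x < b0 ->
  continuous (fun x => RInt (f x) c d) x.
Proof.
intros Hf Hcd Hx; apply continuous_RInt_param; [assumption|].
assert (H : locally x (fun z => a0 < z < b0)).
{ apply (locally_interval _ x a0 b0); simpl; try lra; intros z; simpl; lra. }
revert H; apply filter_imp; intros z Hz t; now apply Hf.
Qed.

Lemma ex_RInt_iter (f : R -> R -> R) (a0 b0 a b c d : R) :
  continuous_strip f a0 b0 -> a0 < a -> a <= b -> b < b0 -> c <= d ->
  ex_RInt (fun x => RInt (f x) c d) a b.
Proof.
intros Hf Ha Hab Hb Hcd; apply (ex_RInt_continuous (V := R_CompleteNormedModule)).
intros x; rewrite Rmin_left, Rmax_right by lra; intros Hx.
apply (continuous_strip_RInt f a0 b0); try assumption; lra.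
Qed.

(** Outward flux through the boundary of [[a, b] x [c, d]] minus the integral of
    the divergence. *)
Definition flux_defect (u v q : R -> R -> R) (a b c d : R) : R :=
  RInt (u b) c d - RInt (u a) c d +
  (RInt (fun x => v x d) a b - RInt (fun x => v x c) a b) -
  RInt (fun x => RInt (q x) c d) a b.

Lemma RInt_split (f : R -> R) a m b : ex_RInt f a m -> ex_RInt f m b ->
  RInt f a b = RInt f a m + RInt f m b.
Proof.
intros H1 H2; symmetry; exact (RInt_Chasles (V := R_CompleteNormedModule) f a m b H1 H2).
Qed.

Lemma flux_defect_split_x (u v q : R -> R -> R) (a0 b0 a m b c d : R) :
  divergence_on u v q a0 b0 -> a0 < a -> a <= m <= b -> b < b0 -> c <= d ->
  flux_defect u v q a b c d = flux_defect u v q a m c d + flux_defect u v q m b c d.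
Proof.
intros H Ha Hm Hb Hcd; destruct (divergence_on_continuous _ _ _ _ _ H) as [Hu [Hv Hq]].
unfold flux_defect.
assert (Ev : forall y, RInt (fun x => v x y) a b =
  RInt (fun x => v x y) a m + RInt (fun x => v x y) m b).
{ intros y; apply RInt_split; (apply (ex_RInt_col v a0 b0); [exact Hv|lra..]). }
assert (Eq : RInt (fun x => RInt (q x) c d) a b =
  RInt (fun x => RInt (q x) c d) a m + RInt (fun x => RInt (q x) c d) m b).
{ apply RInt_split; (apply (ex_RInt_iter q a0 b0); [exact Hq|lra..]). }
generalize (Ev c), (Ev d); lra.
Qed.

Lemma flux_defect_split_y (u v q : R -> R -> R) (a0 b0 a b c m d : R) :
  divergence_on u v q a0 b0 -> a0 < a -> a <= b < b0 -> c <= m <= d ->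
  flux_defect u v q a b c d = flux_defect u v q a b c m + flux_defect u v q a b m d.
Proof.
intros H Ha Hb Hm; destruct (divergence_on_continuous _ _ _ _ _ H) as [Hu [Hv Hq]].
unfold flux_defect.
assert (E : RInt (fun x => RInt (q x) c d) a b =
  RInt (fun x => RInt (q x) c m) a b + RInt (fun x => RInt (q x) m d) a b).
{ assert (I : forall c' d', c' <= d' -> ex_RInt (fun x => RInt (q x) c' d') a b).
  { intros c' d' H'; apply (ex_RInt_iter q a0 b0); [exact Hq|lra..]. }
  etransitivity; [|exact (RInt_plus (V := R_CompleteNormedModule) _ _ a b
    (I c m ltac:(lra)) (I m d ltac:(lra)))].
  apply RInt_ext; rewrite Rmin_left, Rmax_right by lra; intros x Hx.
  apply RInt_split; apply (ex_RInt_row q a0 b0); try exact Hq; lra. }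
assert (Eu : forall x, a0 < x < b0 -> RInt (u x) c d = RInt (u x) c m + RInt (u x) m d).
{ intros x Hx; apply RInt_split; now apply (ex_RInt_row u a0 b0). }
generalize (Eu a ltac:(lra)), (Eu b ltac:(lra)); lra.
Qed.

(** The affine part of [(u, v)] at [(x, y)] contributes its constant divergence
    times the area to the flux; the remainders of [u] and [v], being small
    with respect to the size, contribute [o(size^2)], and so does the variation
    of [q]. *)
Lemma flux_defect_small (u v q : R -> R -> R) (a0 b0 x y eps : R) :
  divergence_on u v q a0 b0 -> a0 < x < b0 -> 0 < eps ->
  exists delta, 0 < delta /\ forall a b c d,
    a0 < a -> b < b0 -> a <= x <= b -> c <= y <= d ->
    b - a < delta -> d - c < delta ->
    Rabs (flux_defect u v q a b c d) <= eps * ((b - a) + (d - c)) ^ 2.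
Proof.
intros H Hx He; destruct (divergence_on_continuous _ _ _ _ _ H) as [Hu [Hv Hq]].
destruct (H x y Hx) as [_ [ux [uy [vx [vy [Du [Dv Eq]]]]]]].
set (e := mkposreal (eps / 3) ltac:(lra)).
destruct (Du e) as [d1 H1], (Dv e) as [d2 H2], (Hq x y Hx e) as [d3 H3].
simpl in H1, H2, H3; clear Du Dv.
exists (Rmin d1 (Rmin d2 d3)).
split; [repeat apply Rmin_pos; apply cond_pos|].
intros a b c d Ha Hb Hax Hcy Hw Hl.
assert (M1 := Rmin_l d1 (Rmin d2 d3)); assert (M2 := Rmin_r d1 (Rmin d2 d3)).
assert (M3 := Rmin_l d2 d3); assert (M4 := Rmin_r d2 d3).
set (s := (b - a) + (d - c)).
assert (Hin : forall x' y', a <= x' <= b -> c <= y' <= d ->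
  Rabs (x' - x) <= b - a /\ Rabs (y' - y) <= d - c /\
  Rmax (Rabs (x' - x)) (Rabs (y' - y)) <= s).
{ intros x' y' Hx' Hy'.
  assert (Rabs (x' - x) <= b - a) by (apply Rabs_le; lra).
  assert (Rabs (y' - y) <= d - c) by (apply Rabs_le; lra).
  repeat split; try assumption; apply Rmax_lub; unfold s; lra. }
assert (Ru : forall x' y', a <= x' <= b -> c <= y' <= d ->
  Rabs (u x' y' - u x y - (ux * (x' - x) + uy * (y' - y))) <= eps / 3 * s).
{ intros x' y' Hx' Hy'; destruct (Hin x' y' Hx' Hy') as [I1 [I2 I3]].
  eapply Rle_trans; [apply H1; lra|apply Rmult_le_compat_l; [lra|exact I3]]. }
assert (Rv : forall x' y', a <= x' <= b -> c <= y' <= d ->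
  Rabs (v x' y' - v x y - (vx * (x' - x) + vy * (y' - y))) <= eps / 3 * s).
{ intros x' y' Hx' Hy'; destruct (Hin x' y' Hx' Hy') as [I1 [I2 I3]].
  eapply Rle_trans; [apply H2; lra|apply Rmult_le_compat_l; [lra|exact I3]]. }
assert (Rq : forall x' y', a <= x' <= b -> c <= y' <= d ->
  Rabs (q x' y' - q x y) <= eps / 3).
{ intros x' y' Hx' Hy'; destruct (Hin x' y' Hx' Hy') as [I1 [I2 _]].
  apply Rlt_le, H3; lra. }
assert (Fu : Rabs (RInt (u b) c d - RInt (u a) c d - ux * (b - a) * (d - c))
             <= 2 * (eps / 3) * s * (d - c)).
{ rewrite <- (RInt_minus (V := R_CompleteNormedModule) (u b) (u a))
    by (apply (ex_RInt_row u a0 b0); [exact Hu|lra]).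
  apply RInt_near_const; [lra| |].
  - apply (ex_RInt_minus (V := R_NormedModule) (u b) (u a));
      (apply (ex_RInt_row u a0 b0); [exact Hu|lra]).
  - intros y' Hy'.
    assert (A := Ru b y' ltac:(lra) Hy'); assert (B := Ru a y' ltac:(lra) Hy').
    apply Rabs_le_between in A; apply Rabs_le_between in B.
    unfold minus, plus, opp; simpl; apply Rabs_le; lra. }
assert (Fv : Rabs (RInt (fun x' => v x' d) a b - RInt (fun x' => v x' c) a b
               - vy * (d - c) * (b - a)) <= 2 * (eps / 3) * s * (b - a)).
{ rewrite <- (RInt_minus (V := R_CompleteNormedModule)
    (fun x' => v x' d) (fun x' => v x' c)) by (apply (ex_RInt_col v a0 b0); [exact Hv|lra..]).
  apply RInt_near_const; [lra| |].
  - apply (ex_RInt_minus (V := R_NormedModule) (fun x' => v x' d) (fun x' => v x' c));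
      (apply (ex_RInt_col v a0 b0); [exact Hv|lra..]).
  - intros x' Hx'.
    assert (A := Rv x' d Hx' ltac:(lra)); assert (B := Rv x' c Hx' ltac:(lra)).
    apply Rabs_le_between in A; apply Rabs_le_between in B.
    unfold minus, plus, opp; simpl; apply Rabs_le; lra. }
assert (Fq : Rabs (RInt (fun x' => RInt (q x') c d) a b
               - q x y * (d - c) * (b - a)) <= eps / 3 * (d - c) * (b - a)).
{ apply RInt_near_const; [lra|apply (ex_RInt_iter q a0 b0); [exact Hq|lra..]|].
  intros x' Hx'; apply RInt_near_const; [lra|apply (ex_RInt_row q a0 b0); [exact Hq|lra]|].
  intros y' Hy'; now apply Rq. }
rewrite Eq in Fq.
apply Rabs_le_between in Fu; apply Rabs_le_between in Fv; apply Rabs_le_between in Fq.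
assert (Hwl : eps / 3 * ((d - c) * (b - a)) <= eps / 3 * s ^ 2).
{ apply Rmult_le_compat_l; [lra|unfold s; nra]. }
unfold flux_defect; apply Rabs_le.
replace (eps * s ^ 2) with (2 * (eps / 3) * s * (d - c) + 2 * (eps / 3) * s * (b - a)
  + eps / 3 * s ^ 2) by (unfold s; field).
lra.
Qed.

(** The flux defect is additive and [o(size^2)] at every point, hence zero. *)
Lemma divergence_theorem (u v q : R -> R -> R) (a0 b0 a b c d : R) :
  divergence_on u v q a0 b0 -> a0 < a -> a <= b < b0 -> c <= d ->
  RInt (u b) c d - RInt (u a) c d +
  (RInt (fun x => v x d) a b - RInt (fun x => v x c) a b) =
  RInt (fun x => RInt (q x) c d) a b.
Proof.
intros H Ha Hb Hcd; apply Rminus_diag_uniq.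
apply (rect_bisection (flux_defect u v q) a b c d); try lra.
- intros; apply (flux_defect_split_x u v q a0 b0); try assumption; lra.
- intros; apply (flux_defect_split_y u v q a0 b0); try assumption; lra.
- intros x y eps Hx Hy He.
  destruct (flux_defect_small u v q a0 b0 x y eps H ltac:(lra) He) as [delta [Hd H']].
  exists delta; split; [assumption|].
  intros a' b' c' d' H1 H2 H3 H4; apply H'; lra.
Qed.

(** * Holomorphy in real and in polar coordinates *)

Lemma differentiable_pt_lim_id1 (x y : R) :
  differentiable_pt_lim (fun u _ => u) x y 1 0.
Proof. apply (differentiable_pt_lim_proj1_0 (fun u => u)), derivable_pt_lim_id. Qed.

Lemma differentiable_pt_lim_id2 (x y : R) :
  differentiable_pt_lim (fun _ v => v) x y 0 1.
Proof.
intros eps; exists eps; intros u v _ _.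
replace (v - y - (0 * (u - x) + 1 * (v - y))) with 0 by ring.
rewrite Rabs_R0; apply Rmult_le_pos; [apply Rlt_le, cond_pos|].
apply Rle_trans with (1 := Rabs_pos (u - x)), Rmax_l.
Qed.

Lemma differentiable_pt_lim_proj2 (f : R -> R) (x y l : R) :
  is_derive f y l -> differentiable_pt_lim (fun _ v => f v) x y 0 l.
Proof.
intros H; apply is_derive_Reals in H.
replace 0 with (l * 0 + 0 * 0) by ring; replace l with (l * 1 + 0 * 1) at 2 by ring.
apply (differentiable_pt_lim_comp (fun u _ => f u) (fun _ v => v) (fun _ v => v));
  try apply differentiable_pt_lim_id2.
now apply differentiable_pt_lim_proj1_0.
Qed.

Lemma differentiable_pt_lim_Rmult (x y : R) :
  differentiable_pt_lim Rmult x y y x.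
Proof.
intros eps; exists eps; intros u v Hu Hv.
replace (u * v - x * y - (y * (u - x) + x * (v - y))) with ((u - x) * (v - y)) by ring.
rewrite Rabs_mult; apply Rmult_le_compat; try apply Rabs_pos; [lra|apply Rmax_r].
Qed.

Lemma differentiable_pt_lim_Rplus (x y : R) :
  differentiable_pt_lim Rplus x y 1 1.
Proof.
intros eps; exists eps; intros u v Hu Hv.
replace (u + v - (x + y) - (1 * (u - x) + 1 * (v - y))) with 0 by ring.
rewrite Rabs_R0; apply Rmult_le_pos; [apply Rlt_le, cond_pos|].
apply Rle_trans with (1 := Rabs_pos (u - x)), Rmax_l.
Qed.

Lemma differentiable_pt_lim_eq (f : R -> R -> R) (x y a b a' b' : R) :
  differentiable_pt_lim f x y a b -> a = a' -> b = b' ->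
  differentiable_pt_lim f x y a' b'.
Proof. now intros H <- <-. Qed.

Lemma differentiable_pt_lim_mult (f g : R -> R -> R) (x y fx fy gx gy : R) :
  differentiable_pt_lim f x y fx fy -> differentiable_pt_lim g x y gx gy ->
  differentiable_pt_lim (fun u v => f u v * g u v) x y
    (g x y * fx + f x y * gx) (g x y * fy + f x y * gy).
Proof.
intros Hf Hg; apply (differentiable_pt_lim_comp Rmult); try assumption.
apply differentiable_pt_lim_Rmult.
Qed.

Lemma differentiable_pt_lim_plus (f g : R -> R -> R) (x y fx fy gx gy : R) :
  differentiable_pt_lim f x y fx fy -> differentiable_pt_lim g x y gx gy ->
  differentiable_pt_lim (fun u v => f u v + g u v) x y (fx + gx) (fy + gy).
Proof.
intros Hf Hg; apply (differentiable_pt_lim_eq _ _ _ (1 * fx + 1 * gx) (1 * fy + 1 * gy));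
  try ring.
apply (differentiable_pt_lim_comp Rplus); try assumption.
apply differentiable_pt_lim_Rplus.
Qed.

Lemma differentiable_pt_lim_const (k x y : R) :
  differentiable_pt_lim (fun _ _ => k) x y 0 0.
Proof.
apply (differentiable_pt_lim_proj2 (fun _ => k)); apply (is_derive_const (V := R_NormedModule)).
Qed.

Lemma differentiable_pt_lim_scal (k : R) (f : R -> R -> R) (x y fx fy : R) :
  differentiable_pt_lim f x y fx fy ->
  differentiable_pt_lim (fun u v => k * f u v) x y (k * fx) (k * fy).
Proof.
intros H; eapply differentiable_pt_lim_eq;
  [apply (differentiable_pt_lim_mult (fun _ _ => k) f);
   [apply differentiable_pt_lim_const|exact H]| |]; ring.
Qed.

(** [g + i h] has the complex derivative [a + i b]: the shape of the two
    gradients expresses the Cauchy-Riemann equations. *)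
Definition holo_at (g h : R -> R -> R) (x y : R) : Prop :=
  exists a b, differentiable_pt_lim g x y a (- b) /\ differentiable_pt_lim h x y b a.

(** Multiplication by [- i].  It exchanges the roles of the real and the
    imaginary part, so that results on real parts apply to imaginary parts. *)
Lemma holo_at_mul_minus_i (g h : R -> R -> R) (x y : R) :
  holo_at g h x y -> holo_at h (fun u v => -1 * g u v) x y.
Proof.
intros [a [b [Hg Hh]]]; exists b, (- a); split.
- now apply (differentiable_pt_lim_eq _ _ _ b a); try ring.
- apply (differentiable_pt_lim_eq _ _ _ (-1 * a) (-1 * - b)); try ring.
  now apply differentiable_pt_lim_scal.
Qed.

Lemma holo_at_continuity (g h : R -> R -> R) (x y : R) :
  holo_at g h x y -> continuity_2d_pt g x y /\ continuity_2d_pt h x y.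
Proof.
intros [a [b [Hg Hh]]]; split; apply differentiable_continuity_pt.
- now exists a, (- b).
- now exists b, a.
Qed.

Definition polar (f : R -> R -> R) (r t : R) : R := f (r * cos t) (r * sin t).

Lemma continuity_2d_pt_comp (f g h : R -> R -> R) (x y : R) :
  continuity_2d_pt f (g x y) (h x y) ->
  continuity_2d_pt g x y -> continuity_2d_pt h x y ->
  continuity_2d_pt (fun u v => f (g u v) (h u v)) x y.
Proof.
intros Hf Hg Hh eps; destruct (Hf eps) as [d Hd].
destruct (Hg d) as [d1 H1], (Hh d) as [d2 H2].
exists (mkposreal (Rmin d1 d2) ltac:(apply Rmin_pos; apply cond_pos)).
simpl; intros u v Hu Hv.
assert (M1 := Rmin_l d1 d2); assert (M2 := Rmin_r d1 d2).
apply Hd; [apply H1|apply H2]; lra.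
Qed.

Lemma differentiable_polar (r t : R) :
  differentiable_pt_lim (fun r t => r * cos t) r t (cos t) (- (r * sin t)) /\
  differentiable_pt_lim (fun r t => r * sin t) r t (sin t) (r * cos t).
Proof.
split.
- eapply differentiable_pt_lim_eq;
    [apply (differentiable_pt_lim_mult (fun r _ => r) (fun _ t => cos t));
     [apply differentiable_pt_lim_id1|
      apply differentiable_pt_lim_proj2; auto_derive; [exact I|reflexivity]]| |]; ring.
- eapply differentiable_pt_lim_eq;
    [apply (differentiable_pt_lim_mult (fun r _ => r) (fun _ t => sin t));
     [apply differentiable_pt_lim_id1|
      apply differentiable_pt_lim_proj2; auto_derive; [exact I|reflexivity]]| |]; ring.
Qed.

Lemma continuity_polar (f : R -> R -> R) (r t : R) :
  continuity_2d_pt f (r * cos t) (r * sin t) -> continuity_2d_pt (polar f) r t.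
Proof.
intros H; apply (continuity_2d_pt_comp f (fun r t => r * cos t) (fun r t => r * sin t));
  [exact H| |];
  apply differentiable_continuity_pt; [exists (cos t), (- (r * sin t))|exists (sin t), (r * cos t)];
  apply differentiable_polar.
Qed.

Lemma polar_CR (g h : R -> R -> R) (r t : R) :
  holo_at g h (r * cos t) (r * sin t) ->
  exists gr gt hr ht,
    differentiable_pt_lim (polar g) r t gr gt /\
    differentiable_pt_lim (polar h) r t hr ht /\ ht = r * gr /\ gt = - (r * hr).
Proof.
intros [a [b [Hg Hh]]]; destruct (differentiable_polar r t) as [Dx Dy].
exists (a * cos t + - b * sin t), (a * - (r * sin t) + - b * (r * cos t)),
  (b * cos t + a * sin t), (b * - (r * sin t) + a * (r * cos t)).
repeat split; try ring.
- now apply (differentiable_pt_lim_comp g (fun r t => r * cos t) (fun r t => r * sin t)).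
- now apply (differentiable_pt_lim_comp h (fun r t => r * cos t) (fun r t => r * sin t)).
Qed.

Definition circle_pairing (f : R -> R -> R) (phi : R -> R) (r : R) : R :=
  RInt (fun t => polar f r t * phi t) 0 (2 * PI).

Definition holo_annulus (g h : R -> R -> R) (r1 r2 : R) : Prop :=
  forall x y, r1 ^ 2 < x ^ 2 + y ^ 2 < r2 ^ 2 -> holo_at g h x y.

Lemma polar_radius (r t : R) : (r * cos t) ^ 2 + (r * sin t) ^ 2 = r ^ 2.
Proof.
generalize (sin2_cos2 t); unfold Rsqr; intros H.
replace (r ^ 2) with (r ^ 2 * (sin t * sin t + cos t * cos t)) by (rewrite H; ring).
ring.
Qed.

Lemma holo_annulus_polar (g h : R -> R -> R) (r1 r2 r t : R) :
  holo_annulus g h r1 r2 -> 0 <= r1 -> r1 < r < r2 ->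
  holo_at g h (r * cos t) (r * sin t).
Proof. intros H H1 Hr; apply H; rewrite polar_radius; nra. Qed.

Lemma sin_cos_2PI : cos (2 * PI) = cos 0 /\ sin (2 * PI) = sin 0.
Proof. now rewrite cos_2PI, sin_2PI, cos_0, sin_0. Qed.

(** The divergence theorem in the coordinates [(r, t)] for the field
    [(g phi, - h phi / r)].  By the polar Cauchy-Riemann equations the
    derivatives of [g] and [h] cancel in its divergence, leaving
    [- h phi' / r]; the sides [t = 0] and [t = 2 PI] cancel by periodicity. *)
Lemma circle_pairing_variation (g h : R -> R -> R) (r1 r2 : R) (phi dphi : R -> R) (a b : R) :
  holo_annulus g h r1 r2 -> 0 <= r1 ->
  (forall t, is_derive phi t (dphi t)) -> (forall t, continuous dphi t) ->
  phi (2 * PI) = phi 0 ->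
  r1 < a -> a <= b < r2 ->
  circle_pairing g phi b - circle_pairing g phi a =
  RInt (fun r => RInt (fun t => - / r * (polar h r t * dphi t)) 0 (2 * PI)) a b.
Proof.
intros Hf Hr1 Hphi Hdphi Hper Ha Hb.
assert (HPI := PI_RGT_0).
set (u := fun r t => polar g r t * phi t).
set (v := fun r t => - / r * (polar h r t * phi t)).
set (q := fun r t => - / r * (polar h r t * dphi t)).
assert (H : divergence_on u v q r1 r2).
{ intros r t Hr.
  assert (Hz := holo_annulus_polar _ _ _ _ _ t Hf Hr1 Hr).
  assert (Dinv : differentiable_pt_lim (fun r _ => - / r) r t (/ r ^ 2) 0).
  { apply (differentiable_pt_lim_proj1_0 (fun r => - / r)), is_derive_Reals.
    auto_derive; [lra|field; lra]. }
  destruct (polar_CR _ _ _ _ Hz) as [gr [gt [hr [ht [Dg [Dh [Eh Eg]]]]]]].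
  assert (Dphi := differentiable_pt_lim_proj2 phi r t _ (Hphi t)).
  split.
  - apply continuity_2d_pt_mult;
      [apply differentiable_continuity_pt; now exists (/ r ^ 2), 0|].
    apply continuity_2d_pt_mult.
    + apply differentiable_continuity_pt; now exists hr, ht.
    + apply (continuity_1d_2d_pt_comp dphi (fun _ t => t)).
      * apply continuity_pt_filterlim, Hdphi.
      * apply continuity_2d_pt_id2.
  - do 4 eexists; repeat split.
    + apply differentiable_pt_lim_mult; [exact Dg|exact Dphi].
    + apply (differentiable_pt_lim_mult (fun r _ => - / r)); [exact Dinv|].
      apply differentiable_pt_lim_mult; [exact Dh|exact Dphi].
    + unfold q; rewrite Eh; field; lra. }
assert (D := divergence_theorem u v q r1 r2 a b 0 (2 * PI) H Ha Hb ltac:(lra)).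
unfold circle_pairing; fold u.
assert (E : RInt (fun x => v x (2 * PI)) a b = RInt (fun x => v x 0) a b).
{ apply RInt_ext; intros x _; unfold v, polar.
  destruct sin_cos_2PI as [-> ->]; now rewrite Hper. }
change (RInt (u b) 0 (2 * PI) - RInt (u a) 0 (2 * PI) =
  RInt (fun x => RInt (q x) 0 (2 * PI)) a b); lra.
Qed.

(** * Mean values over circles *)

Lemma eq_of_interior_constant (f : R -> R) (a b : R) :
  a <= b -> (forall x, a <= x <= b -> continuous f x) ->
  (forall x y, a < x -> x <= y < b -> f y = f x) -> f b = f a.
Proof.
intros Hab Hf Hc.
destruct (MVT_gen f a b (fun _ => 0)) as [c [_ E]];
  rewrite ?Rmin_left, ?Rmax_right by assumption.
- intros x Hx.
  apply (is_derive_ext_loc (fun _ => f x)); [|apply (is_derive_const (V := R_NormedModule))].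
  apply (locally_interval _ x a b); simpl; try lra; simpl; intros y Hy1 Hy2.
  destruct (Rle_dec x y); [symmetry|]; apply Hc; lra.
- intros x Hx; apply continuity_pt_filterlim, Hf, Hx.
- lra.
Qed.

(** Mean value property for a function that is continuous on the disc and
    holomorphic off one circle.  The exceptional circle is needed for
    difference quotients, whose holomorphy at the centre is not known
    beforehand.  The means over circles are constant on either side of the
    exceptional radius, and continuity of the means joins the two sides and
    reaches the radius [0]. *)
Lemma circle_mean (g h : R -> R -> R) (r0 rho r : R) :
  holo_annulus g h 0 r0 -> holo_annulus g h r0 rho ->
  (forall x y, x ^ 2 + y ^ 2 < rho ^ 2 -> continuity_2d_pt g x y) ->
  0 <= r0 < rho -> 0 <= r < rho ->
  RInt (polar g r) 0 (2 * PI) = 2 * PI * g 0 0.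
Proof.
intros H1 H2 Hg Hr0 Hr; assert (HPI := PI_RGT_0).
set (A := fun r => RInt (polar g r) 0 (2 * PI)).
assert (Hpolar : continuous_strip (polar g) (- rho) rho).
{ intros x t Hx; apply continuity_polar, Hg; rewrite polar_radius; nra. }
assert (HA : forall x, 0 <= x < rho -> continuous A x).
{ intros x Hx; apply (continuous_strip_RInt _ (- rho) rho); try assumption; lra. }
assert (Hconst : forall r1 r2 x y, 0 <= r1 -> holo_annulus g h r1 r2 ->
  r1 < x -> x <= y < r2 -> A y = A x).
{ intros r1 r2 x y Hr1 H Hx Hy.
  assert (V := circle_pairing_variation g h r1 r2 (fun _ => 1) (fun _ => 0) x y H Hr1
    (fun t => is_derive_const (V := R_NormedModule) 1 t)
    (fun t => continuous_const 0 t) eq_refl Hx Hy).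
  assert (E : forall z, circle_pairing g (fun _ => 1) z = A z).
  { intros z; apply RInt_ext; intros t _; apply Rmult_1_r. }
  rewrite !E, (RInt_ext _ (fun _ => 0)) in V.
  - rewrite RInt_const in V; unfold scal in V; simpl in V; unfold mult in V; simpl in V; lra.
  - intros s _; rewrite (RInt_ext _ (fun _ => 0)).
    + rewrite RInt_const; unfold scal; simpl; unfold mult; simpl; ring.
    + intros t _; now rewrite !Rmult_0_r. }
assert (A0 : A 0 = 2 * PI * g 0 0).
{ unfold A; rewrite (RInt_ext _ (fun _ => g 0 0)).
  - rewrite RInt_const; unfold scal; simpl; unfold mult; simpl; ring.
  - intros t _; unfold polar; now rewrite !Rmult_0_l. }
change (A r = 2 * PI * g 0 0); rewrite <- A0.
destruct (Rle_dec r r0) as [Hle|Hgt].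
- apply eq_of_interior_constant; [lra|intros; apply HA; lra|].
  intros x y Hx Hy; apply (Hconst 0 r0); try assumption; lra.
- transitivity (A r0).
  + apply eq_of_interior_constant; [lra|intros; apply HA; lra|].
    intros x y Hx Hy; apply (Hconst r0 rho); try assumption; lra.
  + apply eq_of_interior_constant; [lra|intros; apply HA; lra|].
    intros x y Hx Hy; apply (Hconst 0 r0); try assumption; lra.
Qed.

(** * An estimate of Cauchy type *)

Lemma holo_at_mult (g h g' h' : R -> R -> R) (x y : R) :
  holo_at g h x y -> holo_at g' h' x y ->
  holo_at (fun u v => g u v * g' u v + -1 * (h u v * h' u v))
          (fun u v => g u v * h' u v + h u v * g' u v) x y.
Proof.
intros [a [b [Dg Dh]]] [a' [b' [Dg' Dh']]].
exists (g' x y * a + g x y * a' - h' x y * b - h x y * b'),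
  (g' x y * b + g x y * b' + h' x y * a + h x y * a'); split.
- eapply differentiable_pt_lim_eq; [apply differentiable_pt_lim_plus;
   [apply differentiable_pt_lim_mult; eassumption|
    apply differentiable_pt_lim_scal, differentiable_pt_lim_mult; eassumption]| |]; ring.
- eapply differentiable_pt_lim_eq; [apply differentiable_pt_lim_plus;
   apply differentiable_pt_lim_mult; eassumption| |]; ring.
Qed.

Lemma holo_at_affine (a b c d x y : R) :
  holo_at (fun u v => a * u + b * v + c) (fun u v => a * v + - b * u + d) x y.
Proof.
exists a, (- b); split; rewrite ?Ropp_involutive.
- eapply differentiable_pt_lim_eq; [apply differentiable_pt_lim_plus;
   [apply differentiable_pt_lim_plus; apply differentiable_pt_lim_scal;
     [apply differentiable_pt_lim_id1|apply differentiable_pt_lim_id2]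
   |apply differentiable_pt_lim_const]| |]; ring.
- eapply differentiable_pt_lim_eq; [apply differentiable_pt_lim_plus;
   [apply differentiable_pt_lim_plus; apply differentiable_pt_lim_scal;
     [apply differentiable_pt_lim_id2|apply differentiable_pt_lim_id1]
   |apply differentiable_pt_lim_const]| |]; ring.
Qed.

Lemma holo_at_plus (g h g' h' : R -> R -> R) (x y : R) :
  holo_at g h x y -> holo_at g' h' x y ->
  holo_at (fun u v => g u v + g' u v) (fun u v => h u v + h' u v) x y.
Proof.
intros [a [b [Dg Dh]]] [a' [b' [Dg' Dh']]]; exists (a + a'), (b + b'); split.
- eapply differentiable_pt_lim_eq; [apply differentiable_pt_lim_plus; eassumption| |]; ring.
- eapply differentiable_pt_lim_eq; [apply differentiable_pt_lim_plus; eassumption| |]; ring.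
Qed.

Lemma holo_at_ext (g h g' h' : R -> R -> R) (x y : R) :
  locally_2d (fun u v => g u v = g' u v /\ h u v = h' u v) x y ->
  holo_at g h x y -> holo_at g' h' x y.
Proof.
intros H [a [b [Dg Dh]]]; exists a, b; split;
  [apply (differentiable_pt_lim_ext g)|apply (differentiable_pt_lim_ext h)]; try assumption;
  revert H; apply locally_2d_impl, locally_2d_forall; tauto.
Qed.

Definition dist2 (x0 y0 x y : R) : R := (x - x0) ^ 2 + (y - y0) ^ 2.

Lemma differentiable_dist2_inv (x0 y0 x y : R) : dist2 x0 y0 x y <> 0 ->
  differentiable_pt_lim (fun u v => / dist2 x0 y0 u v) x y
    (- (2 * (x - x0)) / dist2 x0 y0 x y ^ 2) (- (2 * (y - y0)) / dist2 x0 y0 x y ^ 2).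
Proof.
intros HD.
assert (H : differentiable_pt_lim (dist2 x0 y0) x y (2 * (x - x0)) (2 * (y - y0))).
{ eapply differentiable_pt_lim_eq; [apply (differentiable_pt_lim_plus
    (fun u _ => (u - x0) ^ 2) (fun _ v => (v - y0) ^ 2));
   [apply (differentiable_pt_lim_proj1_0 (fun u => (u - x0) ^ 2)), is_derive_Reals;
    auto_derive; [exact I|reflexivity]
   |apply (differentiable_pt_lim_proj2 (fun u => (u - y0) ^ 2));
    auto_derive; [exact I|reflexivity]]| |]; simpl; ring. }
eapply differentiable_pt_lim_eq;
 [apply (differentiable_pt_lim_comp (fun u _ => / u) (dist2 x0 y0) (dist2 x0 y0));
  [apply (differentiable_pt_lim_proj1_0 (fun u => / u)), is_derive_Reals;
   auto_derive; [exact HD|reflexivity]|exact H|exact H]| |]; field; assumption.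
Qed.

Lemma holo_at_inv (x0 y0 x y : R) : dist2 x0 y0 x y <> 0 ->
  holo_at (fun u v => (u - x0) * / dist2 x0 y0 u v)
          (fun u v => - (v - y0) * / dist2 x0 y0 u v) x y.
Proof.
intros HD; assert (H := differentiable_dist2_inv x0 y0 x y HD).
set (D := dist2 x0 y0 x y) in *.
assert (ED : D = (x - x0) ^ 2 + (y - y0) ^ 2) by reflexivity.
exists (((y - y0) ^ 2 - (x - x0) ^ 2) / D ^ 2), (2 * (x - x0) * (y - y0) / D ^ 2); split.
- eapply differentiable_pt_lim_eq; [apply (differentiable_pt_lim_mult (fun u _ => u - x0));
   [apply (differentiable_pt_lim_proj1_0 (fun u => u - x0)), is_derive_Reals;
    auto_derive; [exact I|reflexivity]|exact H]| |]; cbv beta; fold D.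
  + replace (((y - y0) ^ 2 - (x - x0) ^ 2) / D ^ 2)
      with ((D - 2 * (x - x0) ^ 2) / D ^ 2) by (rewrite ED at 1; unfold Rdiv; ring).
    field; assumption.
  + field; assumption.
- eapply differentiable_pt_lim_eq; [apply (differentiable_pt_lim_mult (fun _ v => - (v - y0)));
   [apply (differentiable_pt_lim_proj2 (fun v => - (v - y0)));
    auto_derive; [exact I|reflexivity]|exact H]| |]; cbv beta; fold D.
  + field; assumption.
  + replace (((y - y0) ^ 2 - (x - x0) ^ 2) / D ^ 2)
      with ((2 * (y - y0) ^ 2 - D) / D ^ 2) by (rewrite ED at 1; unfold Rdiv; ring).
    field; assumption.
Qed.

Definition holo_disc (g h : R -> R -> R) : Prop :=
  forall x y, x ^ 2 + y ^ 2 < 1 -> holo_at g h x y.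

(** Real part of the difference quotient of [g + i h] at [(x0, y0)], completed
    by the value [a] there.  The imaginary part is the real part of the
    quotient of [- i (g + i h) = h - i g]. *)
Definition quot_re (g h : R -> R -> R) (x0 y0 a x y : R) : R :=
  if Req_EM_T (dist2 x0 y0 x y) 0 then a else
  ((g x y - g x0 y0) * (x - x0) + (h x y - h x0 y0) * (y - y0)) / dist2 x0 y0 x y.

Lemma dist2_0 (x0 y0 x y : R) : dist2 x0 y0 x y = 0 -> x = x0 /\ y = y0.
Proof.
unfold dist2; intros H.
generalize (pow2_ge_0 (x - x0)) (pow2_ge_0 (y - y0)); intros Hx Hy.
split; apply Rminus_diag_uniq, Rsqr_0_uniq; rewrite Rsqr_pow2; lra.
Qed.

Lemma dist2_max (x0 y0 x y : R) :
  Rmax (Rabs (x - x0)) (Rabs (y - y0)) ^ 2 <= dist2 x0 y0 x y.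
Proof.
unfold dist2; rewrite <- (pow2_abs (x - x0)), <- (pow2_abs (y - y0)).
apply Rmax_case; nra.
Qed.

Lemma quot_re_continuous_at_center (g h : R -> R -> R) (x0 y0 a b : R) :
  differentiable_pt_lim g x0 y0 a (- b) -> differentiable_pt_lim h x0 y0 b a ->
  continuity_2d_pt (quot_re g h x0 y0 a) x0 y0.
Proof.
intros Dg Dh eps.
set (e := mkposreal (eps / 3) ltac:(generalize (cond_pos eps); lra)).
destruct (Dg e) as [d1 H1], (Dh e) as [d2 H2]; simpl in H1, H2.
exists (mkposreal (Rmin d1 d2) ltac:(apply Rmin_pos; apply cond_pos)); simpl.
intros x y Hx Hy.
assert (M1 := Rmin_l d1 d2); assert (M2 := Rmin_r d1 d2).
specialize (H1 x y ltac:(lra) ltac:(lra)); specialize (H2 x y ltac:(lra) ltac:(lra)).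
unfold quot_re at 2.
destruct (Req_EM_T (dist2 x0 y0 x0 y0) 0) as [_|N];
  [|exfalso; apply N; unfold dist2; ring].
unfold quot_re; destruct (Req_EM_T (dist2 x0 y0 x y) 0) as [E|N].
{ rewrite Rminus_diag, Rabs_R0; apply cond_pos. }
assert (HM := dist2_max x0 y0 x y).
set (m := Rmax (Rabs (x - x0)) (Rabs (y - y0))) in *.
set (D := dist2 x0 y0 x y) in *.
assert (HD : 0 < D).
{ assert (0 <= D) by (apply Rplus_le_le_0_compat; apply pow2_ge_0).
  destruct (Rle_lt_or_eq_dec 0 D); [assumption|assumption|congruence]. }
set (e1 := g x y - g x0 y0 - (a * (x - x0) + - b * (y - y0))) in *.
set (e2 := h x y - h x0 y0 - (b * (x - x0) + a * (y - y0))) in *.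
replace (((g x y - g x0 y0) * (x - x0) + (h x y - h x0 y0) * (y - y0)) / D - a)
  with ((e1 * (x - x0) + e2 * (y - y0)) / D).
2:{ assert (E : (g x y - g x0 y0) * (x - x0) + (h x y - h x0 y0) * (y - y0) =
      e1 * (x - x0) + e2 * (y - y0) + a * D) by (unfold e1, e2, D, dist2; ring).
    rewrite E; field; lra. }
assert (Hm : 0 <= m) by (apply Rle_trans with (1 := Rabs_pos (x - x0)), Rmax_l).
assert (B : Rabs (e1 * (x - x0) + e2 * (y - y0)) <= 2 * (eps / 3 * m ^ 2)).
{ eapply Rle_trans; [apply Rabs_triang|]; rewrite !Rabs_mult.
  assert (Rabs e1 * Rabs (x - x0) <= eps / 3 * m * m).
  { apply Rmult_le_compat; try apply Rabs_pos; [exact H1|apply Rmax_l]. }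
  assert (Rabs e2 * Rabs (y - y0) <= eps / 3 * m * m).
  { apply Rmult_le_compat; try apply Rabs_pos; [exact H2|apply Rmax_r]. }
  simpl pow; lra. }
unfold Rdiv; rewrite Rabs_mult, (Rabs_pos_eq (/ D)) by (apply Rlt_le, Rinv_0_lt_compat, HD).
apply (Rmult_lt_reg_r D); [exact HD|].
rewrite Rmult_assoc, Rinv_l, Rmult_1_r by lra.
generalize (cond_pos eps); intros He; nra.
Qed.

Lemma quot_holo (g h : R -> R -> R) (x0 y0 a b x y : R) :
  holo_at g h x y -> dist2 x0 y0 x y <> 0 ->
  holo_at (quot_re g h x0 y0 a) (quot_re h (fun u v => -1 * g u v) x0 y0 b) x y.
Proof.
intros H HD.
assert (Hl : locally_2d (fun u v => dist2 x0 y0 u v <> 0) x y).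
{ assert (HC : continuity_2d_pt (dist2 x0 y0) x y).
  { unfold dist2; simpl.
    repeat (apply continuity_2d_pt_plus || apply continuity_2d_pt_mult ||
      apply continuity_2d_pt_minus || apply continuity_2d_pt_const ||
      apply continuity_2d_pt_id1 || apply continuity_2d_pt_id2). }
  exact (continuity_2d_pt_neq_0 _ _ _ HC HD). }
eapply holo_at_ext; [|apply holo_at_mult;
  [apply holo_at_plus; [exact H|apply (holo_at_affine 0 0 (- g x0 y0) (- h x0 y0))]
  |apply (holo_at_inv x0 y0), HD]].
revert Hl; apply locally_2d_impl, locally_2d_forall; intros u v Huv.
unfold quot_re; destruct (Req_EM_T (dist2 x0 y0 u v) 0); [contradiction|].
split; field; assumption.
Qed.

(** The quotient [(f(z) - f(z0)) / (z - z0)] extends continuously to the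
    centre by the derivative. *)
Lemma holo_at_div_continuous (g h : R -> R -> R) (x0 y0 : R) :
  holo_disc g h -> x0 ^ 2 + y0 ^ 2 < 1 ->
  exists k l : R -> R -> R,
    (forall x y, x ^ 2 + y ^ 2 < 1 ->
       continuity_2d_pt k x y /\ continuity_2d_pt l x y) /\
    (forall x y, x ^ 2 + y ^ 2 < 1 -> dist2 x0 y0 x y <> 0 -> holo_at k l x y) /\
    (forall x y, dist2 x0 y0 x y <> 0 ->
      k x y = ((g x y - g x0 y0) * (x - x0) + (h x y - h x0 y0) * (y - y0)) / dist2 x0 y0 x y /\
      l x y = ((h x y - h x0 y0) * (x - x0) - (g x y - g x0 y0) * (y - y0)) / dist2 x0 y0 x y).
Proof.
intros H Hz; destruct (H x0 y0 Hz) as [a [b [Dg Dh]]].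
exists (quot_re g h x0 y0 a), (quot_re h (fun u v => -1 * g u v) x0 y0 b).
assert (Hk : forall x y, x ^ 2 + y ^ 2 < 1 -> dist2 x0 y0 x y <> 0 ->
  holo_at (quot_re g h x0 y0 a) (quot_re h (fun u v => -1 * g u v) x0 y0 b) x y).
{ intros x y Hxy; apply quot_holo, H, Hxy. }
split; [|split; [exact Hk|]].
- intros x y Hxy; destruct (Req_EM_T (dist2 x0 y0 x y) 0) as [E|N].
  + apply dist2_0 in E as [-> ->]; split.
    * exact (quot_re_continuous_at_center g h x0 y0 a b Dg Dh).
    * apply (quot_re_continuous_at_center h (fun u v => -1 * g u v) x0 y0 b (- a)).
      -- now rewrite Ropp_involutive.
      -- eapply differentiable_pt_lim_eq; [apply differentiable_pt_lim_scal, Dg| |]; ring.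
  + apply holo_at_continuity, Hk; assumption.
- intros x y N; unfold quot_re; destruct (Req_EM_T (dist2 x0 y0 x y) 0); [contradiction|].
  split; [reflexivity|field; assumption].
Qed.

Lemma polar_continuous (f : R -> R -> R) (r t : R) :
  continuity_2d_pt f (r * cos t) (r * sin t) -> continuous (polar f r) t.
Proof.
intros H; apply continuity_2d_pt_slice2; now apply continuity_polar.
Qed.

Definition modulus (g h : R -> R -> R) (x y : R) : R := sqrt (g x y ^ 2 + h x y ^ 2).

Lemma ex_RInt_modulus (g h : R -> R -> R) (r : R) :
  holo_disc g h -> 0 <= r < 1 -> ex_RInt (polar (modulus g h) r) 0 (2 * PI).
Proof.
intros H Hr; apply (ex_RInt_continuous (V := R_CompleteNormedModule)); intros t _.
assert (Hc : (r * cos t) ^ 2 + (r * sin t) ^ 2 < 1) by (rewrite polar_radius; nra).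
destruct (holo_at_continuity _ _ _ _ (H _ _ Hc)) as [Cg Ch].
apply polar_continuous.
apply (continuity_1d_2d_pt_comp sqrt (fun u v => g u v ^ 2 + h u v ^ 2)).
- apply continuity_pt_sqrt; nra.
- simpl; repeat (apply continuity_2d_pt_plus || apply continuity_2d_pt_mult ||
    apply continuity_2d_pt_const); assumption.
Qed.

(** With [f0 = A + i B], [f = f1 + i f2] and [w = z / (z - z0)], the left-hand
    side is the real part of [conj f0 * (f - f0) * w].  The modulus of [w] is at
    most [R / (R - s)], which bounds the part with [f]; and the real part of [w]
    is at least [1/2] because [w = 1 / (1 - z0 / z)] with [|z0 / z| < 1], which bounds
    the part with [f0]. *)
Lemma cauchy_kernel_bound (A B f1 f2 x y x0 y0 R s : R) :
  0 <= s < R -> x ^ 2 + y ^ 2 = R ^ 2 -> x0 ^ 2 + y0 ^ 2 = s ^ 2 ->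
  let D := dist2 x0 y0 x y in
  let q1 := ((f1 - A) * (x - x0) + (f2 - B) * (y - y0)) / D in
  let q2 := ((f2 - B) * (x - x0) - (f1 - A) * (y - y0)) / D in
  0 < D /\
  (A * x + B * y) * q1 - (A * y - B * x) * q2 <=
  sqrt (A ^ 2 + B ^ 2) * (R / (R - s)) * sqrt (f1 ^ 2 + f2 ^ 2) - (A ^ 2 + B ^ 2) / 2.
Proof.
intros Hs HR H0 D q1 q2.
assert (CS : x * x0 + y * y0 <= R * s).
{ apply Rnot_lt_le; intros Hlt.
  assert ((x * x0 + y * y0) ^ 2 <= (R * s) ^ 2).
  { rewrite Rpow_mult_distr, <- HR, <- H0.
    generalize (pow2_ge_0 (x * y0 - y * x0)); lra. }
  assert (0 <= R * s) by nra; nra. }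
assert (ED : D = R ^ 2 + s ^ 2 - 2 * (x * x0 + y * y0)).
{ unfold D, dist2; rewrite <- HR, <- H0; ring. }
assert (HD : (R - s) ^ 2 <= D) by (rewrite ED; lra).
assert (Hp : 0 < (R - s) ^ 2) by (apply pow_lt; lra).
split; [lra|].
set (K1 := (x * (x - x0) + y * (y - y0)) / D).
set (K2 := (y * (x - x0) - x * (y - y0)) / D).
set (P := A * f1 + B * f2); set (Q := A * f2 - B * f1).
assert (E : (A * x + B * y) * q1 - (A * y - B * x) * q2 =
  (P * K1 - Q * K2) - (A ^ 2 + B ^ 2) * K1).
{ unfold q1, q2, K1, K2, P, Q; field; lra. }
assert (HK1 : / 2 <= K1).
{ unfold K1; apply (Rmult_le_reg_r D); [lra|].
  unfold Rdiv; rewrite Rmult_assoc, Rinv_l by lra.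
  replace (x * (x - x0) + y * (y - y0)) with (R ^ 2 - (x * x0 + y * y0))
    by (rewrite <- HR; ring).
  rewrite ED; nra. }
assert (HKn : K1 ^ 2 + K2 ^ 2 <= (R / (R - s)) ^ 2).
{ assert (EK : K1 ^ 2 + K2 ^ 2 = R ^ 2 / D).
  { replace (K1 ^ 2 + K2 ^ 2) with ((x ^ 2 + y ^ 2) * ((x - x0) ^ 2 + (y - y0) ^ 2) / D ^ 2)
      by (unfold K1, K2; field; lra).
    rewrite HR; change ((x - x0) ^ 2 + (y - y0) ^ 2) with D; field; lra. }
  rewrite EK; unfold Rdiv; rewrite Rpow_mult_distr, pow_inv.
  apply Rmult_le_compat_l; [nra|].
  apply Rinv_le_contravar; assumption. }
rewrite E.
assert (HPQ : P * K1 - Q * K2 <= sqrt (A ^ 2 + B ^ 2) * (R / (R - s)) * sqrt (f1 ^ 2 + f2 ^ 2)).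
{ assert (HRs : 0 < R / (R - s)) by (apply Rdiv_lt_0_compat; lra).
  apply Rle_trans with (sqrt ((P * K1 - Q * K2) ^ 2)).
  { rewrite <- Rsqr_pow2, sqrt_Rsqr_abs; apply Rle_abs. }
  rewrite (Rmult_assoc (sqrt _)), (Rmult_comm (R / (R - s))), <- Rmult_assoc.
  rewrite <- sqrt_mult by nra.
  rewrite <- (sqrt_pow2 (R / (R - s))) by lra.
  rewrite <- sqrt_mult by nra.
  apply sqrt_le_1_alt.
  apply Rle_trans with ((A ^ 2 + B ^ 2) * (f1 ^ 2 + f2 ^ 2) * (K1 ^ 2 + K2 ^ 2)).
  - replace ((A ^ 2 + B ^ 2) * (f1 ^ 2 + f2 ^ 2)) with (P ^ 2 + Q ^ 2)
      by (unfold P, Q; ring).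
    generalize (pow2_ge_0 (P * K2 + Q * K1)); lra.
  - apply Rmult_le_compat_l; [nra|exact HKn]. }
assert (0 <= A ^ 2 + B ^ 2) by nra.
assert ((A ^ 2 + B ^ 2) * / 2 <= (A ^ 2 + B ^ 2) * K1) by (apply Rmult_le_compat_l; assumption).
lra.
Qed.

(** Integrate [cauchy_kernel_bound] over the circle: the function
    [conj f(z0) * z * (f(z) - f(z0)) / (z - z0)] vanishes at [0], so by
    [circle_mean] its integral does too. *)
Lemma cauchy_estimate (g h : R -> R -> R) (x0 y0 s r : R) :
  holo_disc g h -> x0 ^ 2 + y0 ^ 2 = s ^ 2 -> 0 <= s < r -> r < 1 ->
  PI * modulus g h x0 y0 <= r / (r - s) * RInt (polar (modulus g h) r) 0 (2 * PI).
Proof.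
intros H Hz Hs Hr; assert (HPI := PI_RGT_0).
destruct (holo_at_div_continuous g h x0 y0 H ltac:(rewrite Hz; nra)) as [k [l [Hc [Hh Hkl]]]].
set (A := g x0 y0); set (B := h x0 y0); set (N := modulus g h x0 y0).
assert (HN : 0 <= N) by apply sqrt_pos.
assert (HN2 : N ^ 2 = A ^ 2 + B ^ 2) by (apply pow2_sqrt; nra).
(* [F + i G = conj f(z0) * z * (k + i l)], where [k + i l] is the difference quotient. *)
set (F := fun x y => (A * x + B * y + 0) * k x y + -1 * ((A * y + - B * x + 0) * l x y)).
set (G := fun x y => (A * x + B * y + 0) * l x y + (A * y + - B * x + 0) * k x y).
assert (HF : forall x y, x ^ 2 + y ^ 2 < 1 -> continuity_2d_pt F x y).
{ intros x y Hxy; destruct (Hc x y Hxy) as [Ck Cl].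
  destruct (holo_at_continuity _ _ _ _ (holo_at_affine A B 0 0 x y)) as [C1 C2].
  apply continuity_2d_pt_plus; [now apply continuity_2d_pt_mult|].
  apply continuity_2d_pt_mult; [apply continuity_2d_pt_const|].
  now apply continuity_2d_pt_mult. }
assert (HFG : forall x y, x ^ 2 + y ^ 2 < 1 -> dist2 x0 y0 x y <> 0 -> holo_at F G x y).
{ intros x y Hxy N0; apply holo_at_mult; [apply holo_at_affine|now apply Hh]. }
assert (Hmean : RInt (polar F r) 0 (2 * PI) = 0).
{ rewrite (circle_mean F G s 1 r); try lra.
  - apply Rmult_eq_0_compat_l; unfold F; ring.
  - intros x y Hxy; apply HFG; [nra|].
    intros E; apply dist2_0 in E as [-> ->]; lra.
  - intros x y Hxy; apply HFG; [nra|].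
    intros E; apply dist2_0 in E as [-> ->]; lra.
  - intros x y Hxy; apply HF; lra. }
set (M := RInt (polar (modulus g h) r) 0 (2 * PI)).
assert (Hcirc : forall t, (r * cos t) ^ 2 + (r * sin t) ^ 2 < 1).
{ intros t; rewrite polar_radius; nra. }
assert (Hmod : ex_RInt (polar (modulus g h) r) 0 (2 * PI)).
{ apply ex_RInt_modulus; [exact H|lra]. }
assert (HexF : ex_RInt (polar F r) 0 (2 * PI)).
{ apply (ex_RInt_continuous (V := R_CompleteNormedModule)); intros t _.
  apply polar_continuous, HF, Hcirc. }
assert (Hle : RInt (polar F r) 0 (2 * PI) <=
  RInt (fun t => N * (r / (r - s)) * polar (modulus g h) r t - N ^ 2 / 2) 0 (2 * PI)).
{ apply RInt_le; [lra|exact HexF| |].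
  - apply (ex_RInt_minus (V := R_NormedModule)); [|apply ex_RInt_const].
    now apply (ex_RInt_scal (V := R_NormedModule)).
  - intros t _; unfold polar.
    destruct (cauchy_kernel_bound A B (g (r * cos t) (r * sin t)) (h (r * cos t) (r * sin t))
      (r * cos t) (r * sin t) x0 y0 r s Hs (polar_radius r t) Hz) as [HD HB].
    unfold F; destruct (Hkl (r * cos t) (r * sin t) ltac:(lra)) as [-> ->].
    rewrite HN2; fold A B; unfold N, modulus; fold A B; lra. }
assert (E : RInt (fun t => N * (r / (r - s)) * polar (modulus g h) r t - N ^ 2 / 2) 0 (2 * PI)
  = N * (r / (r - s)) * M - PI * N ^ 2).
{ rewrite (RInt_minus (V := R_CompleteNormedModule)
    (fun t => N * (r / (r - s)) * polar (modulus g h) r t) (fun _ => N ^ 2 / 2)).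
  - rewrite (RInt_scal (V := R_CompleteNormedModule)) by exact Hmod.
    rewrite RInt_const; fold M.
    unfold minus, plus, opp, scal; simpl; unfold mult; simpl; field; lra.
  - now apply (ex_RInt_scal (V := R_NormedModule)).
  - apply ex_RInt_const. }
rewrite E, Hmean in Hle.
assert (HM : 0 <= M).
{ apply RInt_ge_0; [lra|exact Hmod|intros t _; apply sqrt_pos]. }
assert (Hrs : 0 < r / (r - s)) by (apply Rdiv_lt_0_compat; lra).
destruct (Rle_lt_or_eq_dec 0 N HN) as [Hpos|Hzero].
- apply (Rmult_le_reg_l N); [exact Hpos|]; lra.
- rewrite <- Hzero, Rmult_0_r; apply Rmult_le_pos; lra.
Qed.

(** * Growth of functions with bounded circle means of order p *)

Lemma rpow_ge_0 (x p : R) : 0 <= rpow x p.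
Proof.
unfold rpow; destruct (Rlt_dec 0 x); [apply Rlt_le, exp_pos|lra].
Qed.

(** [x = x^p x^{1-p}]: trades an integral of order 1 for one of order [p] and a bound. *)
Lemma le_rpow_mult (x T p : R) :
  0 < p <= 1 -> x <= T -> 0 < T -> x <= rpow x p * Rpower T (1 - p).
Proof.
intros Hp HxT HT; unfold rpow; destruct (Rlt_dec 0 x) as [Hx|Hx].
- assert (E : x = Rpower x p * Rpower x (1 - p)).
  { rewrite <- Rpower_plus; replace (p + (1 - p)) with 1 by ring.
    now rewrite Rpower_1. }
  rewrite E at 1; apply Rmult_le_compat_l; [apply Rlt_le, exp_pos|].
  apply Rle_Rpower_l; lra.
- rewrite Rmult_0_l; lra.
Qed.

Lemma Rpower_le_1 (x e : R) : 0 < x <= 1 -> 0 <= e -> Rpower x e <= 1.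
Proof.
intros Hx He; assert (H := Rle_Rpower_l x 1 e He Hx).
unfold Rpower at 2 in H; rewrite ln_1, Rmult_0_r, exp_0 in H; exact H.
Qed.

Lemma Rpower_ge_1 (x e : R) : 0 < x <= 1 -> e <= 0 -> 1 <= Rpower x e.
Proof.
intros Hx He; replace e with (- - e) by ring; rewrite Rpower_Ropp.
rewrite <- Rinv_1; apply Rinv_le_contravar; [apply exp_pos|].
apply Rpower_le_1; lra.
Qed.

(** The powers of [d] on the left have the total exponent
    [n - 1 - n (1 - p) = n p - 1 >= 0]. *)
Lemma Rpower_absorb (U d p : R) (n : nat) :
  0 < U -> 0 < d < 1 -> 1 <= INR n * p ->
  d ^ n * (/ d * Rpower (U / d ^ n) (1 - p)) <= Rpower U (1 - p).
Proof.
intros HU Hd Hn.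
rewrite <- !Rpower_pow by lra.
replace (/ d) with (Rpower d (-1)) by
  (replace (-1) with (- (1)) by ring; rewrite Rpower_Ropp, Rpower_1; lra).
unfold Rdiv; rewrite <- Rpower_Ropp.
rewrite <- Rpower_mult_distr by (try apply exp_pos; assumption).
rewrite Rpower_mult.
replace (Rpower d (INR n) * (Rpower d (-1) * (Rpower U (1 - p) * Rpower d (- INR n * (1 - p)))))
  with (Rpower U (1 - p) * Rpower d (INR n * p - 1)).
2:{ replace (INR n * p - 1) with (INR n + (-1 + - INR n * (1 - p))) by ring.
    rewrite !Rpower_plus; ring. }
rewrite <- (Rmult_1_r (Rpower U (1 - p))) at 2.
apply Rmult_le_compat_l; [apply Rlt_le, exp_pos|].
apply Rpower_le_1; lra.
Qed.

Lemma Rpower_self_bound (U K p : R) :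
  0 < U -> 0 < p -> 0 < K -> U <= K * Rpower U (1 - p) -> U <= Rpower K (/ p).
Proof.
intros HU Hp HK H.
assert (E : Rpower U p <= K).
{ apply (Rmult_le_reg_r (Rpower U (1 - p))); [apply exp_pos|].
  rewrite <- Rpower_plus; replace (p + (1 - p)) with 1 by ring.
  now rewrite Rpower_1. }
replace U with (Rpower (Rpower U p) (/ p)).
- apply Rle_Rpower_l; [apply Rlt_le, Rinv_0_lt_compat, Hp|].
  split; [apply exp_pos|exact E].
- rewrite Rpower_mult, Rinv_r by lra; now apply Rpower_1.
Qed.

(** The majorant [m] lets the bound for a bicomplex function be transferred to
    its components by comparison of integrands. *)
Definition circle_Lp_bound (g h : R -> R -> R) (p M : R) : Prop :=
  forall r, 0 < r < 1 -> exists (m : R -> R) (I : R),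
    is_RInt m 0 (2 * PI) I /\ I <= M /\
    forall t, rpow (polar (modulus g h) r t) p <= m t.

Lemma cauchy_estimate_Lp (g h : R -> R -> R) (p M x y s r T : R) :
  holo_disc g h -> 0 < p <= 1 -> circle_Lp_bound g h p M ->
  x ^ 2 + y ^ 2 = s ^ 2 -> 0 <= s < r -> r < 1 -> 0 < T ->
  (forall t, polar (modulus g h) r t <= T) ->
  modulus g h x y <= M * (/ (r - s) * Rpower T (1 - p)).
Proof.
intros H Hp HM Hz Hs Hr HT Hbound; assert (HPI := PI2_1).
destruct (HM r ltac:(lra)) as [m [I [HI [HIM Hm]]]].
assert (Hpow : 0 < Rpower T (1 - p)) by apply exp_pos.
assert (HI0 : 0 <= I).
{ apply (is_RInt_ge_0 m 0 (2 * PI)); try lra; [exact HI|].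
  intros t _; apply Rle_trans with (2 := Hm t), rpow_ge_0. }
assert (Hint : RInt (polar (modulus g h) r) 0 (2 * PI) <= Rpower T (1 - p) * I).
{ apply (is_RInt_le (polar (modulus g h) r) (fun t => Rpower T (1 - p) * m t) 0 (2 * PI)).
  - lra.
  - apply (RInt_correct (V := R_CompleteNormedModule)), ex_RInt_modulus; [assumption|lra].
  - now apply (is_RInt_scal (V := R_NormedModule)).
  - intros t _.
    eapply Rle_trans; [apply (le_rpow_mult _ T p Hp (Hbound t) HT)|].
    rewrite Rmult_comm; apply Rmult_le_compat_l; [lra|apply Hm]. }
assert (HC := cauchy_estimate g h x y s r H Hz Hs Hr).
assert (Hrs : 0 < / (r - s)) by (apply Rinv_0_lt_compat; lra).
assert (N0 : 0 <= modulus g h x y) by apply sqrt_pos.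
apply Rle_trans with (PI * modulus g h x y); [nra|].
eapply Rle_trans; [exact HC|].
apply Rle_trans with (1 * / (r - s) * (Rpower T (1 - p) * M)); [|lra].
assert (R0 : 0 <= RInt (polar (modulus g h) r) 0 (2 * PI)).
{ apply RInt_ge_0; [lra|apply ex_RInt_modulus; [assumption|lra]|intros t _; apply sqrt_pos]. }
apply Rmult_le_compat; [apply Rmult_le_pos; lra|exact R0|apply Rmult_le_compat_r; lra|].
eapply Rle_trans; [exact Hint|apply Rmult_le_compat_l; lra].
Qed.

Definition weighted_values (g h : R -> R -> R) (rho : R) (n : nat) (v : R) : Prop :=
  exists x y s, x ^ 2 + y ^ 2 = s ^ 2 /\ 0 <= s < rho /\ v = modulus g h x y * (rho - s) ^ n.

(** A qualitative bound, depending on [rho]: it makes the supremum finite, so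
    that the inequality [S <= K S^{1-p}] can be used. *)
Lemma weighted_values_bound (g h : R -> R -> R) (rho : R) (n : nat) :
  holo_disc g h -> 0 < rho < 1 -> bound (weighted_values g h rho n).
Proof.
intros H Hrho; assert (HPI := PI2_1).
(* Any radius strictly between [rho] and [1] would do. *)
set (r := (1 + rho) / 2).
set (B := r / (r - rho) * RInt (polar (modulus g h) r) 0 (2 * PI)).
exists B; intros v [x [y [s [Hz [Hs ->]]]]].
assert (HC := cauchy_estimate g h x y s r H Hz ltac:(unfold r; lra) ltac:(unfold r; lra)).
assert (R0 : 0 <= RInt (polar (modulus g h) r) 0 (2 * PI)).
{ apply RInt_ge_0; [lra|apply ex_RInt_modulus; [assumption|unfold r; lra]|
   intros t _; apply sqrt_pos]. }
assert (N0 : 0 <= modulus g h x y) by apply sqrt_pos.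
assert (HB : r / (r - s) * RInt (polar (modulus g h) r) 0 (2 * PI) <= B).
{ apply Rmult_le_compat_r; [exact R0|]; apply Rmult_le_compat_l; [unfold r; lra|].
  apply Rinv_le_contravar; unfold r; lra. }
assert (Hpow : 0 <= (rho - s) ^ n <= 1).
{ split; [apply pow_le; lra|]; rewrite <- (pow1 n); apply pow_incr; lra. }
nra.
Qed.

(** The bound on the right is independent of [rho].  For the supremum [S] of
    the weighted values, apply the Cauchy estimate at distance [s] from the
    origin with the circle of radius [r = (rho + s) / 2], on which the modulus is
    at most [S / (rho - r)^n]: this gives [S <= 2 M (2^n S)^{1-p}]. *)
Lemma growth_on_smaller_disc (g h : R -> R -> R) (p M : R) (n : nat) (rho : R) :
  holo_disc g h -> 0 < p <= 1 -> circle_Lp_bound g h p M -> 0 <= M ->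
  1 <= INR n * p -> 0 < rho < 1 ->
  forall v, weighted_values g h rho n v -> v <= Rpower (2 ^ n * (2 * M + 1)) (/ p).
Proof.
intros H Hp HM HM0 Hn Hrho v Hv.
destruct (completeness _ (weighted_values_bound g h rho n H Hrho)) as [S [HS1 HS2]].
{ now exists v. }
assert (H2n : 1 <= 2 ^ n) by (apply pow_R1_Rle; lra).
apply Rle_trans with (1 := HS1 v Hv).
(* Real powers of [S] are meaningful for [S > 0] only. *)
destruct (Rle_lt_dec S 0) as [HS|HS].
{ apply Rle_trans with (1 := HS), Rlt_le, exp_pos. }
set (U := 2 ^ n * S).
assert (HU : 0 < U) by (apply Rmult_lt_0_compat; lra).
apply Rle_trans with U; [unfold U; nra|].
apply Rpower_self_bound; [exact HU|lra|apply Rmult_lt_0_compat; lra|].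
unfold U at 1; rewrite Rmult_assoc; apply Rmult_le_compat_l; [lra|].
apply HS2; clear v Hv; intros v [x [y [s [Hz [Hs ->]]]]].
set (d := rho - s); set (r := (rho + s) / 2).
assert (Hd : 0 < d < 1) by (unfold d; lra).
assert (Hdn : 0 < d ^ n) by (apply pow_lt; lra).
assert (Hpow : 0 < Rpower U (1 - p)) by apply exp_pos.
assert (HC := cauchy_estimate_Lp g h p M x y s r (U / d ^ n) H Hp HM Hz
  ltac:(unfold r; lra) ltac:(unfold r; lra) ltac:(apply Rdiv_lt_0_compat; assumption)).
assert (Hmod : modulus g h x y <= M * (/ (r - s) * Rpower (U / d ^ n) (1 - p))).
{ apply HC; intros t.
  assert (Hw := HS1 (polar (modulus g h) r t * (rho - r) ^ n)).
  apply (Rmult_le_reg_r (d ^ n)); [exact Hdn|].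
  unfold Rdiv; rewrite Rmult_assoc, Rinv_l, Rmult_1_r by lra.
  unfold U; apply Rle_trans with (2 ^ n * (polar (modulus g h) r t * (rho - r) ^ n)).
  - replace d with (2 * (rho - r)) by (unfold d, r; field).
    rewrite Rpow_mult_distr; lra.
  - apply Rmult_le_compat_l; [lra|]; apply Hw.
    exists (r * cos t), (r * sin t), r; split; [apply polar_radius|].
    split; [unfold r; lra|reflexivity]. }
clear HC.
replace (/ (r - s)) with (2 * / d) in Hmod by (unfold r, d; field; lra).
assert (Ha := Rpower_absorb U d p n HU Hd Hn).
apply Rle_trans with (M * (2 * / d * Rpower (U / d ^ n) (1 - p)) * d ^ n).
{ apply Rmult_le_compat_r; lra. }
apply Rle_trans with (2 * M * Rpower U (1 - p)).
- replace (M * (2 * / d * Rpower (U / d ^ n) (1 - p)) * d ^ n)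
    with (2 * M * (d ^ n * (/ d * Rpower (U / d ^ n) (1 - p)))) by ring.
  apply Rmult_le_compat_l; lra.
- lra.
Qed.

Lemma polynomial_growth (g h : R -> R -> R) (p M : R) :
  holo_disc g h -> 0 < p <= 1 -> circle_Lp_bound g h p M ->
  exists (n : nat) (K : R), 0 <= K /\ forall x y s,
    x ^ 2 + y ^ 2 = s ^ 2 -> 0 <= s < 1 -> modulus g h x y <= K / (1 - s) ^ n.
Proof.
intros H Hp HM; assert (HPI := PI_RGT_0).
assert (HM0 : 0 <= M).
{ destruct (HM (/ 2) ltac:(lra)) as [m [I [HI [HIM Hm]]]].
  apply Rle_trans with (2 := HIM).
  apply (is_RInt_ge_0 m 0 (2 * PI)); try lra; [exact HI|].
  intros t _; apply Rle_trans with (2 := Hm t), rpow_ge_0. }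
destruct (INR_unbounded (/ p)) as [n Hn].
assert (Hn' : 1 <= INR n * p).
{ rewrite <- (Rinv_l p) by lra; apply Rmult_le_compat_r; lra. }
set (K := Rpower (2 ^ n * (2 * M + 1)) (/ p)).
assert (HK : 0 < K) by apply exp_pos.
exists n, (2 ^ n * K); split.
{ apply Rmult_le_pos; [apply pow_le; lra|lra]. }
intros x y s Hz Hs.
assert (Hw := growth_on_smaller_disc g h p M n ((1 + s) / 2) H Hp HM HM0 Hn' ltac:(lra)
  (modulus g h x y * ((1 + s) / 2 - s) ^ n)).
fold K in Hw.
assert (Hpos : 0 < (1 - s) ^ n) by (apply pow_lt; lra).
apply (Rmult_le_reg_r ((1 - s) ^ n)); [exact Hpos|].
unfold Rdiv; rewrite Rmult_assoc, Rinv_l, Rmult_1_r by lra.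
replace (1 - s) with (2 * ((1 + s) / 2 - s)) by field.
rewrite Rpow_mult_distr.
replace (modulus g h x y * (2 ^ n * ((1 + s) / 2 - s) ^ n)) with
  (2 ^ n * (modulus g h x y * ((1 + s) / 2 - s) ^ n)) by ring.
apply Rmult_le_compat_l; [apply pow_le; lra|apply Hw].
exists x, y, s; repeat split; try lra; exact Hz.
Qed.

(** * Limits of the pairings with test functions *)

Definition smooth_periodic (phi : R -> R) : Prop :=
  (forall n t, ex_derive_n phi n t) /\ (forall t, phi (t + 2 * PI) = phi t).

Lemma smooth_periodic_Derive (phi : R -> R) :
  smooth_periodic phi -> smooth_periodic (Derive phi).
Proof.
intros [Hs Hp]; split.
- intros [|n] t; [exact I|].
  apply (ex_derive_ext (Derive_n phi (S n))); [|exact (Hs (S (S n)) t)].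
  intros s; change (Derive phi) with (Derive_n phi 1).
  rewrite Derive_n_comp; f_equal; ring.
- intros t; rewrite <- (Derive_ext _ _ t Hp).
  rewrite (Derive_comp phi (fun t => t + 2 * PI)).
  + replace (Derive (fun t : R => t + 2 * PI) t) with 1; [ring|].
    symmetry; apply is_derive_unique; auto_derive; [exact I|ring].
  + exact (Hs 1%nat _).
  + auto_derive; exact I.
Qed.

Lemma smooth_periodic_is_derive (phi : R -> R) :
  smooth_periodic phi -> forall t, is_derive phi t (Derive phi t).
Proof. intros [Hs _] t; apply Derive_correct, (Hs 1%nat). Qed.

Lemma smooth_periodic_continuous (phi : R -> R) :
  smooth_periodic phi -> forall t, continuous phi t.
Proof.
intros [Hs _] t; apply (ex_derive_continuous (V := R_NormedModule)), (Hs 1%nat).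
Qed.

Lemma smooth_periodic_ends (phi : R -> R) :
  smooth_periodic phi -> phi (2 * PI) = phi 0.
Proof. intros [_ Hp]; rewrite <- (Hp 0); f_equal; ring. Qed.

Lemma smooth_periodic_bounded (phi : R -> R) :
  smooth_periodic phi -> exists B, 0 <= B /\ forall t, 0 <= t <= 2 * PI -> Rabs (phi t) <= B.
Proof.
intros H; assert (HPI := PI_RGT_0).
destruct (continuity_ab_maj (fun t => Rabs (phi t)) 0 (2 * PI)) as [m [Hm _]]; [lra| |].
- intros t _; apply continuity_pt_filterlim.
  apply (continuous_comp phi Rabs); [now apply smooth_periodic_continuous|].
  apply (continuous_Rabs (phi t)).
- exists (Rabs (phi m)); split; [apply Rabs_pos|exact Hm].
Qed.

Lemma holo_disc_annulus (g h : R -> R -> R) : holo_disc g h -> holo_annulus g h 0 1.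
Proof. intros H x y Hxy; apply H; lra. Qed.

Lemma holo_disc_mul_minus_i (g h : R -> R -> R) :
  holo_disc g h -> holo_disc h (fun x y => -1 * g x y).
Proof. intros H x y Hxy; now apply holo_at_mul_minus_i, H. Qed.

Lemma ex_RInt_circle_pairing (g h : R -> R -> R) (phi : R -> R) (r : R) :
  holo_disc g h -> smooth_periodic phi -> 0 <= r < 1 ->
  ex_RInt (fun t => polar g r t * phi t) 0 (2 * PI).
Proof.
intros H Hphi Hr; apply (ex_RInt_continuous (V := R_CompleteNormedModule)); intros t _.
apply (continuous_mult (K := R_AbsRing)); [|now apply smooth_periodic_continuous].
apply polar_continuous, (holo_at_continuity g h), H; rewrite polar_radius; nra.
Qed.

Lemma RInt_scal_R (k : R) (f : R -> R) (a b : R) :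
  ex_RInt f a b -> RInt (fun x => k * f x) a b = k * RInt f a b.
Proof. intros H; exact (RInt_scal (V := R_CompleteNormedModule) f a b k H). Qed.

Lemma circle_pairing_opp (g h : R -> R -> R) (phi : R -> R) (r : R) :
  holo_disc g h -> smooth_periodic phi -> 0 <= r < 1 ->
  circle_pairing (fun x y => -1 * g x y) phi r = -1 * circle_pairing g phi r.
Proof.
intros H Hphi Hr; unfold circle_pairing.
rewrite <- RInt_scal_R by now apply (ex_RInt_circle_pairing g h).
apply RInt_ext; intros t _; unfold polar; apply Rmult_assoc.
Qed.

(** Bound the integrand in [circle_pairing_variation] by
    [2 C (1 - r)^e], the factor [1 / r] being at most [2], and integrate. *)
Lemma circle_pairing_increment (g h : R -> R -> R) (phi : R -> R) (C e a b : R) :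
  holo_disc g h -> smooth_periodic phi -> e + 1 <> 0 -> 0 <= C ->
  (forall r, / 2 <= r < 1 ->
     Rabs (circle_pairing h (Derive phi) r) <= C * Rpower (1 - r) e) ->
  / 2 <= a -> a <= b < 1 ->
  Rabs (circle_pairing g phi b - circle_pairing g phi a) <=
  2 * C * ((Rpower (1 - a) (e + 1) - Rpower (1 - b) (e + 1)) / (e + 1)).
Proof.
intros H Hphi He HC Hh Ha Hb; assert (HPI := PI_RGT_0).
assert (Hphi' := smooth_periodic_Derive phi Hphi).
assert (Hh' := holo_disc_mul_minus_i g h H).
assert (V := circle_pairing_variation g h 0 1 phi (Derive phi) a b (holo_disc_annulus g h H)
  (Rle_refl 0) (smooth_periodic_is_derive phi Hphi)
  (smooth_periodic_continuous _ Hphi') (smooth_periodic_ends phi Hphi)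
  ltac:(lra) ltac:(lra)).
set (J := fun r => RInt (fun t => - / r * (polar h r t * Derive phi t)) 0 (2 * PI)) in V.
assert (HJ : forall r, / 2 <= r < 1 -> J r = - / r * circle_pairing h (Derive phi) r).
{ intros r Hr; apply RInt_scal_R.
  apply (ex_RInt_circle_pairing h (fun x y => -1 * g x y)); try assumption; lra. }
assert (exJ : ex_RInt J a b).
{ apply (ex_RInt_continuous (V := R_CompleteNormedModule)).
  rewrite Rmin_left, Rmax_right by lra; intros r Hr.
  apply (continuous_strip_RInt (fun r t => - / r * (polar h r t * Derive phi t)) 0 1);
    try lra; clear r Hr; intros r t Hr.
  apply continuity_2d_pt_mult; [|apply continuity_2d_pt_mult].
  - apply continuity_2d_pt_opp, continuity_2d_pt_inv; [apply continuity_2d_pt_id1|lra].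
  - apply continuity_polar, (holo_at_continuity g h), H; rewrite polar_radius; nra.
  - apply (continuity_1d_2d_pt_comp (Derive phi) (fun _ t => t));
      [|apply continuity_2d_pt_id2].
    apply continuity_pt_filterlim; now apply smooth_periodic_continuous. }
rewrite V.
(* [G] is a primitive of [2 C (1 - r)^e]. *)
set (G := fun r => 2 * C * (- Rpower (1 - r) (e + 1) / (e + 1))).
assert (HG : is_RInt (fun r => 2 * C * Rpower (1 - r) e) a b (minus (G b) (G a))).
{ apply (is_RInt_derive (V := R_CompleteNormedModule) G); rewrite Rmin_left, Rmax_right by lra;
    intros r Hr.
  - unfold G, Rpower; auto_derive; [lra|].
    fold (1 - r); replace ((e + 1) * ln (1 - r)) with (e * ln (1 - r) + ln (1 - r)) by ring.
    rewrite exp_plus, exp_ln by lra; field; lra.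
  - apply (ex_derive_continuous (V := R_NormedModule)).
    unfold Rpower; auto_derive; lra. }
replace (2 * C * ((Rpower (1 - a) (e + 1) - Rpower (1 - b) (e + 1)) / (e + 1)))
  with (minus (G b) (G a)) by (unfold minus, plus, opp, G; simpl; field; exact He).
apply (norm_RInt_le (V := R_NormedModule) J (fun r => 2 * C * Rpower (1 - r) e) a b);
  [lra| |exact (RInt_correct (V := R_CompleteNormedModule) J a b exJ)|exact HG].
intros r Hr; change (Rabs (J r) <= 2 * C * Rpower (1 - r) e).
rewrite HJ, Rabs_mult, Rabs_Ropp by lra.
rewrite Rmult_assoc; apply Rmult_le_compat; try apply Rabs_pos; [|apply Hh; lra].
rewrite Rabs_pos_eq; [|apply Rlt_le, Rinv_0_lt_compat; lra].
rewrite <- (Rinv_inv 2); apply Rinv_le_contravar; lra.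
Qed.

Lemma Rabs_mult_minus_1 (x : R) : Rabs (-1 * x) = Rabs x.
Proof. rewrite <- (Rabs_Ropp x); f_equal; ring. Qed.

(** The two components are bounded together, and for all test functions,
    because an integration by parts exchanges the components and replaces the
    test function by its derivative. *)
Definition pairings_growth (g h : R -> R -> R) (e : R) : Prop :=
  forall phi, smooth_periodic phi -> exists C, 0 <= C /\
  forall r, / 2 <= r < 1 ->
    Rabs (circle_pairing g phi r) <= C * Rpower (1 - r) e /\
    Rabs (circle_pairing h phi r) <= C * Rpower (1 - r) e.

Lemma circle_pairing_growth_improve (g h : R -> R -> R) (e : R) (phi : R -> R) (C : R) :
  holo_disc g h -> smooth_periodic phi -> e + 1 < 0 -> 0 <= C ->
  (forall r, / 2 <= r < 1 ->
     Rabs (circle_pairing h (Derive phi) r) <= C * Rpower (1 - r) e) ->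
  exists C', 0 <= C' /\ forall r, / 2 <= r < 1 ->
     Rabs (circle_pairing g phi r) <= C' * Rpower (1 - r) (e + 1).
Proof.
intros H Hphi He HC Hh.
set (A := Rabs (circle_pairing g phi (/ 2))); set (k := 2 * C * (/ - (e + 1))).
assert (HA : 0 <= A) by apply Rabs_pos.
assert (Hinv : 0 < / - (e + 1)) by (apply Rinv_0_lt_compat; lra).
assert (Hk : 0 <= k) by (apply Rmult_le_pos; lra).
exists (A + k); split; [lra|intros r Hr].
assert (HI := circle_pairing_increment g h phi C e (/ 2) r H Hphi ltac:(lra) HC Hh
  (Rle_refl _) ltac:(lra)).
assert (H1 := Rpower_ge_1 (1 - r) (e + 1) ltac:(lra) ltac:(lra)).
assert (H2 : 0 < Rpower (1 - / 2) (e + 1)) by apply exp_pos.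
replace (2 * C * ((Rpower (1 - / 2) (e + 1) - Rpower (1 - r) (e + 1)) / (e + 1)))
  with (k * (Rpower (1 - r) (e + 1) - Rpower (1 - / 2) (e + 1))) in HI
  by (unfold k; field; lra).
assert (HT := Rabs_triang (circle_pairing g phi r - circle_pairing g phi (/ 2))
  (circle_pairing g phi (/ 2))).
fold A in HT.
replace (circle_pairing g phi r - circle_pairing g phi (/ 2) + circle_pairing g phi (/ 2))
  with (circle_pairing g phi r) in HT by ring.
apply Rle_trans with (1 := HT).
nra.
Qed.

Lemma pairings_growth_improve (g h : R -> R -> R) (e : R) :
  holo_disc g h -> e + 1 < 0 -> pairings_growth g h e -> pairings_growth g h (e + 1).
Proof.
intros H He HG phi Hphi.
destruct (HG (Derive phi) (smooth_periodic_Derive phi Hphi)) as [C [HC Hgh]].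
destruct (circle_pairing_growth_improve g h e phi C H Hphi He HC) as [C1 [HC1 H1]].
{ intros r Hr; exact (proj2 (Hgh r Hr)). }
destruct (circle_pairing_growth_improve h (fun x y => -1 * g x y) e phi C
  (holo_disc_mul_minus_i g h H) Hphi He HC) as [C2 [HC2 H2]].
{ intros r Hr; rewrite (circle_pairing_opp g h) by
    (try assumption; try lra; now apply smooth_periodic_Derive).
  rewrite Rabs_mult_minus_1.
  exact (proj1 (Hgh r Hr)). }
exists (C1 + C2); split; [lra|intros r Hr].
specialize (H1 r Hr); specialize (H2 r Hr).
assert (0 < Rpower (1 - r) (e + 1)) by apply exp_pos.
split; nra.
Qed.

(** The exponent is lowered by one half so that the repeated integration
    never meets the exponent [- 1]. *)
Lemma pairings_growth_start (g h : R -> R -> R) (n : nat) (K : R) :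
  holo_disc g h -> 0 <= K ->
  (forall x y s, x ^ 2 + y ^ 2 = s ^ 2 -> 0 <= s < 1 -> modulus g h x y <= K / (1 - s) ^ n) ->
  pairings_growth g h (- (INR n + / 2)).
Proof.
intros H HK Hmod phi Hphi; assert (HPI := PI_RGT_0).
destruct (smooth_periodic_bounded phi Hphi) as [B [HB Hbd]].
assert (HKB : 0 <= 2 * PI * (K * B)).
{ apply Rmult_le_pos; [lra|now apply Rmult_le_pos]. }
exists (2 * PI * (K * B)); split; [exact HKB|intros r Hr].
assert (HR : / (1 - r) ^ n <= Rpower (1 - r) (- (INR n + / 2))).
{ rewrite Rpower_Ropp, <- Rpower_pow by lra.
  apply Rinv_le_contravar; [apply exp_pos|].
  rewrite Rpower_plus; rewrite <- (Rmult_1_r (Rpower (1 - r) (INR n))) at 2.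
  apply Rmult_le_compat_l; [apply Rlt_le, exp_pos|].
  apply Rpower_le_1; lra. }
assert (Hbound : forall f, (forall x y, Rabs (f x y) <= modulus g h x y) ->
  ex_RInt (fun t => polar f r t * phi t) 0 (2 * PI) ->
  Rabs (circle_pairing f phi r) <= 2 * PI * (K * B) * Rpower (1 - r) (- (INR n + / 2))).
{ intros f Hf Hex.
  apply Rle_trans with ((2 * PI - 0) * (K / (1 - r) ^ n * B)).
  - apply abs_RInt_le_const; [lra|exact Hex|intros t Ht].
    rewrite Rabs_mult; apply Rmult_le_compat; try apply Rabs_pos; [|now apply Hbd].
    eapply Rle_trans; [apply Hf|apply Hmod; [apply polar_radius|lra]].
  - replace ((2 * PI - 0) * (K / (1 - r) ^ n * B)) with (2 * PI * (K * B) * / (1 - r) ^ n)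
      by (unfold Rdiv; ring).
    apply Rmult_le_compat_l; [exact HKB|exact HR]. }
split; apply Hbound.
- intros x y; unfold modulus; rewrite <- (sqrt_Rsqr_abs (g x y)), Rsqr_pow2.
  apply sqrt_le_1_alt; generalize (pow2_ge_0 (h x y)); lra.
- apply (ex_RInt_circle_pairing g h); try assumption; lra.
- intros x y; unfold modulus; rewrite <- (sqrt_Rsqr_abs (h x y)), Rsqr_pow2.
  apply sqrt_le_1_alt; generalize (pow2_ge_0 (g x y)); lra.
- apply (ex_RInt_circle_pairing h (fun x y => -1 * g x y)); try assumption; try lra.
  now apply holo_disc_mul_minus_i.
Qed.

Lemma pairings_growth_half (g h : R -> R -> R) (n : nat) :
  holo_disc g h -> pairings_growth g h (- (INR n + / 2)) -> pairings_growth g h (- / 2).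
Proof.
intros H; induction n as [|n IH]; intros HG.
- replace (- / 2) with (- (INR 0 + / 2)) by (simpl; ring); exact HG.
- apply IH; replace (- (INR n + / 2)) with (- (INR (S n) + / 2) + 1)
    by (rewrite S_INR; ring).
  apply pairings_growth_improve; try assumption.
  rewrite S_INR; generalize (pos_INR n); lra.
Qed.

Lemma at_left_Rpower_small (k eps : R) : 0 <= k -> 0 < eps ->
  at_left 1 (fun r => / 2 <= r < 1 /\ k * Rpower (1 - r) (/ 2) < eps).
Proof.
intros Hk He.
set (d := Rmin (/ 2) ((eps / (k + 1)) ^ 2)).
assert (He' : 0 < eps / (k + 1)) by (apply Rdiv_lt_0_compat; lra).
assert (Hd : 0 < d) by (apply Rmin_pos; [lra|now apply pow_lt]).
exists (mkposreal d Hd); intros r Hr Hr1.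
change (Rabs (r - 1) < d) in Hr; apply Rabs_def2 in Hr.
assert (M1 := Rmin_l (/ 2) ((eps / (k + 1)) ^ 2)); fold d in M1.
assert (M2 := Rmin_r (/ 2) ((eps / (k + 1)) ^ 2)); fold d in M2.
split; [lra|].
rewrite Rpower_sqrt by lra.
assert (Hs : sqrt (1 - r) < eps / (k + 1)).
{ rewrite <- (sqrt_pow2 (eps / (k + 1))) by lra; apply sqrt_lt_1_alt; lra. }
assert (E : eps / (k + 1) * (k + 1) = eps) by (field; lra).
generalize (sqrt_pos (1 - r)); nra.
Qed.

(** By [circle_pairing_increment] with [e = - 1/2], the oscillation on [[a, 1)] is
    at most [4 C (1 - a)^{1/2}]. *)
Lemma circle_pairing_converges (g h : R -> R -> R) (phi : R -> R) :
  holo_disc g h -> smooth_periodic phi -> pairings_growth g h (- / 2) ->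
  exists l, filterlim (circle_pairing g phi) (at_left 1) (locally l).
Proof.
intros H Hphi HG.
destruct (HG (Derive phi) (smooth_periodic_Derive phi Hphi)) as [C [HC Hgh]].
apply (filterlim_locally_cauchy (U := R_CompleteSpace) (F := at_left 1)).
intros eps; exists (fun r => / 2 <= r < 1 /\ 4 * C * Rpower (1 - r) (/ 2) < eps).
split; [apply at_left_Rpower_small; [lra|apply cond_pos]|].
assert (Hinc : forall a b, / 2 <= a -> a <= b < 1 ->
  Rabs (circle_pairing g phi b - circle_pairing g phi a) <= 4 * C * Rpower (1 - a) (/ 2)).
{ intros a b Ha Hb.
  eapply Rle_trans; [apply (circle_pairing_increment g h phi C (- / 2)); try assumption|].
  - lra.
  - intros r Hr; exact (proj2 (Hgh r Hr)).
  - replace (- / 2 + 1) with (/ 2) by field.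
    assert (0 < Rpower (1 - b) (/ 2)) by apply exp_pos.
    replace (2 * C * ((Rpower (1 - a) (/ 2) - Rpower (1 - b) (/ 2)) / / 2))
      with (4 * C * (Rpower (1 - a) (/ 2) - Rpower (1 - b) (/ 2))) by field.
    apply Rmult_le_compat_l; lra. }
intros a b [Ha Ha'] [Hb Hb'].
change (Rabs (circle_pairing g phi b - circle_pairing g phi a) < eps).
destruct (Rle_dec a b) as [Hab|Hab].
- apply Rle_lt_trans with (2 := Ha'); apply Hinc; lra.
- rewrite Rabs_minus_sym; apply Rle_lt_trans with (2 := Hb'); apply Hinc; lra.
Qed.

Lemma holo_Lp_boundary_limits (g h : R -> R -> R) (p M : R) :
  holo_disc g h -> 0 < p <= 1 -> circle_Lp_bound g h p M ->
  forall phi, smooth_periodic phi ->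
    (exists l, filterlim (circle_pairing g phi) (at_left 1) (locally l)) /\
    (exists l, filterlim (circle_pairing h phi) (at_left 1) (locally l)).
Proof.
intros H Hp HM phi Hphi.
destruct (polynomial_growth g h p M H Hp HM) as [n [K [HK Hmod]]].
assert (HG := pairings_growth_half g h n H (pairings_growth_start g h n K H HK Hmod)).
split.
- now apply (circle_pairing_converges g h).
- apply (circle_pairing_converges h (fun x y => -1 * g x y)); try assumption;
    [now apply holo_disc_mul_minus_i|].
  intros psi Hpsi; destruct (HG psi Hpsi) as [C [HC HC']].
  exists C; split; [exact HC|intros r Hr].
  rewrite (circle_pairing_opp g h) by (try assumption; lra).
  rewrite Rabs_mult_minus_1.
  destruct (HC' r Hr); now split.
Qed.

(** * From real components to bicomplex values *)

Lemma filterlim_to_pair {T : Type} {U V : UniformSpace} (F : (T -> Prop) -> Prop)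
  {FF : Filter F} (f : T -> U) (g : T -> V) (a : U) (b : V) :
  filterlim f F (locally a) -> filterlim g F (locally b) ->
  filterlim (fun x => (f x, g x)) F (locally (T := prod_UniformSpace U V) (a, b)).
Proof.
intros Hf Hg; apply filterlim_locally; intros eps.
generalize (filter_and _ _ (proj1 (filterlim_locally f a) Hf eps)
  (proj1 (filterlim_locally g b) Hg eps)).
apply filter_imp; intros x [H1 H2]; now split.
Qed.

Lemma filterlim_from_pair {T : Type} {U V : UniformSpace} (F : (T -> Prop) -> Prop)
  {FF : Filter F} (f : T -> prod_UniformSpace U V) (a : prod_UniformSpace U V) :
  filterlim f F (locally a) ->
  filterlim (fun x => fst (f x)) F (locally (fst a)) /\
  filterlim (fun x => snd (f x)) F (locally (snd a)).
Proof.
intros Hf; assert (H := proj1 (filterlim_locally f a) Hf).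
split; apply filterlim_locally; intros eps; generalize (H eps); apply filter_imp;
  intros x [H1 H2]; assumption.
Qed.

Lemma filterlim_lin_comb {T : Type} (F : (T -> Prop) -> Prop) {FF : Filter F}
  (f g : T -> R) (a b k l : R) :
  filterlim f F (locally a) -> filterlim g F (locally b) ->
  filterlim (fun x => k * f x + l * g x) F (locally (k * a + l * b)).
Proof.
intros Hf Hg; apply (filterlim_comp_2 (H := locally (l * b)) (G := locally (k * a))
  (fun x => k * f x) (fun x => l * g x) Rplus).
- apply (filterlim_comp _ _ _ f (fun y => k * y) F (locally a)); [exact Hf|].
  apply (filterlim_scal_r (V := R_NormedModule) k a).
- apply (filterlim_comp _ _ _ g (fun y => l * y) F (locally b)); [exact Hg|].
  apply (filterlim_scal_r (V := R_NormedModule) l b).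
- apply (filterlim_plus (V := R_NormedModule)).
Qed.

Lemma is_RInt_lin_comb (f g : R -> R) (a b If Ig k l : R) :
  is_RInt f a b If -> is_RInt g a b Ig ->
  is_RInt (fun x => k * f x + l * g x) a b (k * If + l * Ig).
Proof.
intros Hf Hg; apply (is_RInt_plus (V := R_NormedModule)
  (fun x => k * f x) (fun x => l * g x)); now apply (is_RInt_scal (V := R_NormedModule)).
Qed.

(** Boundary values for real functions, against real test functions of the angle. *)
Definition is_boundary_functional (f : R -> R -> R) (b : (R -> R) -> R) : Prop :=
  forall phi, smooth_periodic phi ->
    (forall r, 0 < r < 1 -> ex_RInt (fun t => polar f r t * phi t) 0 (2 * PI)) /\
    filterlim (circle_pairing f phi) (at_left 1) (locally (b phi)).

Lemma is_boundary_functional_opp (f : R -> R -> R) (b : (R -> R) -> R) :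
  is_boundary_functional f b ->
  is_boundary_functional (fun x y => - f x y) (fun phi => - b phi).
Proof.
intros H phi Hphi; destruct (H phi Hphi) as [He Hl].
assert (E : forall r, 0 < r < 1 ->
  is_RInt (fun t => polar (fun x y => - f x y) r t * phi t) 0 (2 * PI)
    (- circle_pairing f phi r)).
{ intros r Hr; apply (is_RInt_ext (fun t => opp (polar f r t * phi t))).
  - intros t _; unfold opp; simpl; unfold polar; ring.
  - apply (is_RInt_opp (V := R_NormedModule)).
    apply (RInt_correct (V := R_CompleteNormedModule)), He, Hr. }
split.
- intros r Hr; eexists; apply E, Hr.
- apply (filterlim_ext_loc (fun r => opp (circle_pairing f phi r))).
  + exists (mkposreal (/ 2) ltac:(lra)); intros r Hr Hr1.
    change (Rabs (r - 1) < / 2) in Hr; apply Rabs_def2 in Hr.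
    symmetry; apply (is_RInt_unique (V := R_CompleteNormedModule)), E; lra.
  + apply (filterlim_comp _ _ _ _ opp _ (locally (b phi))); [exact Hl|].
    apply (filterlim_opp (V := R_NormedModule)).
Qed.

Definition left_limit (F : R -> R) : R :=
  epsilon (inhabits 0) (fun l => filterlim F (at_left 1) (locally l)).

Lemma holo_Lp_boundary_functional (g h : R -> R -> R) (p M : R) :
  holo_disc g h -> 0 < p <= 1 -> circle_Lp_bound g h p M ->
  is_boundary_functional g (fun phi => left_limit (circle_pairing g phi)) /\
  is_boundary_functional h (fun phi => left_limit (circle_pairing h phi)).
Proof.
intros H Hp HM; split; intros phi Hphi;
  destruct (holo_Lp_boundary_limits g h p M H Hp HM phi Hphi) as [Lg Lh]; split.
- intros r Hr; apply (ex_RInt_circle_pairing g h); try assumption; lra.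
- exact (epsilon_spec (inhabits 0) _ Lg).
- intros r Hr; apply (ex_RInt_circle_pairing h (fun x y => -1 * g x y)); try assumption;
    [now apply holo_disc_mul_minus_i|lra].
- exact (epsilon_spec (inhabits 0) _ Lh).
Qed.

Lemma expi_periodic (t : R) : expi (t + 2 * PI) = expi t.
Proof.
unfold expi.
rewrite cos_plus, sin_plus, cos_2PI, sin_2PI; f_equal; ring.
Qed.

Lemma smooth_circle_periodic (phi : C -> C) : smooth_circle phi ->
  smooth_periodic (fun t => Re (phi (expi t))) /\
  smooth_periodic (fun t => Im (phi (expi t))).
Proof.
intros H; split; (split; [intros n t; apply H|intros t; now rewrite expi_periodic]).
Qed.

Lemma Cmult_r_expi (r t : R) : Cmult (RtoC r) (expi t) = (r * cos t, r * sin t).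
Proof. unfold Cmult, RtoC, expi; simpl; f_equal; ring. Qed.

Lemma complex_boundary_value (f : C -> C) (b1 b2 : (R -> R) -> R) :
  is_boundary_functional (fun x y => Re (f (x, y))) b1 ->
  is_boundary_functional (fun x y => Im (f (x, y))) b2 ->
  exists fb, is_boundary_value_C f fb.
Proof.
intros H1 H2.
set (re := fun (phi : C -> C) t => Re (phi (expi t))).
set (im := fun (phi : C -> C) t => Im (phi (expi t))).
exists (fun phi => (1 * b1 (re phi) + -1 * b2 (im phi), 1 * b1 (im phi) + 1 * b2 (re phi))).
intros phi Hphi; destruct (smooth_circle_periodic phi Hphi) as [Hre Him].
fold (re phi) in Hre; fold (im phi) in Him.
destruct (H1 _ Hre) as [E1r L1r], (H1 _ Him) as [E1i L1i].
destruct (H2 _ Hre) as [E2r L2r], (H2 _ Him) as [E2i L2i].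
set (P1 := circle_pairing (fun x y => Re (f (x, y)))) in *.
set (P2 := circle_pairing (fun x y => Im (f (x, y)))) in *.
exists (fun r => (1 * P1 (re phi) r + -1 * P2 (im phi) r,
                  1 * P1 (im phi) r + 1 * P2 (re phi) r)); split.
- intros r Hr.
  specialize (E1r r Hr); specialize (E1i r Hr); specialize (E2r r Hr); specialize (E2i r Hr).
  apply (RInt_correct (V := R_CompleteNormedModule)) in E1r, E1i, E2r, E2i.
  apply (is_RInt_fct_extend_pair (U := R_NormedModule) (V := R_NormedModule)).
  + refine (is_RInt_ext _ _ _ _ _ _ (is_RInt_lin_comb _ _ _ _ _ _ 1 (-1) E1r E2i)).
    intros t _; rewrite Cmult_r_expi; unfold polar, re, im, Re, Im; simpl; ring.
  + refine (is_RInt_ext _ _ _ _ _ _ (is_RInt_lin_comb _ _ _ _ _ _ 1 1 E1i E2r)).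
    intros t _; rewrite Cmult_r_expi; unfold polar, re, im, Re, Im; simpl; ring.
- apply (filterlim_to_pair (U := R_UniformSpace) (V := R_UniformSpace) (at_left 1));
    apply filterlim_lin_comb; try assumption; typeclasses eauto.
Qed.

Lemma bicomplex_boundary_value (w : C -> BC) (bp bm : (C -> C) -> C) :
  is_boundary_value_C (fun z => wplus (w z)) bp ->
  is_boundary_value_C (fun z => wminus (w z)) bm ->
  is_boundary_value_BC w (fun phi => BCcomb (bp phi) (bm phi)).
Proof.
intros Hp Hm phi Hphi.
destruct (Hp phi Hphi) as [Ip [EIp Lp]], (Hm phi Hphi) as [Im [EIm Lm]].
(* The real coordinates of [p^+ a + p^- b], written as linear combinations. *)
set (comb := fun a b : C =>
  ((/ 2 * fst a + / 2 * fst b, / 2 * snd a + / 2 * snd b),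
   (- / 2 * snd a + / 2 * snd b, / 2 * fst a + - / 2 * fst b)) : BC).
assert (Ecomb : forall a b, BCcomb a b = comb a b).
{ intros [a b] [c d]; rewrite BCcombE; apply BC_eq; simpl; field. }
exists (fun r => comb (Ip r) (Im r)); split.
- intros r Hr; specialize (EIp r Hr); specialize (EIm r Hr).
  assert (P1 := is_RInt_fct_extend_fst (U := R_NormedModule) (V := R_NormedModule) _ _ _ _ EIp).
  assert (P2 := is_RInt_fct_extend_snd (U := R_NormedModule) (V := R_NormedModule) _ _ _ _ EIp).
  assert (M1 := is_RInt_fct_extend_fst (U := R_NormedModule) (V := R_NormedModule) _ _ _ _ EIm).
  assert (M2 := is_RInt_fct_extend_snd (U := R_NormedModule) (V := R_NormedModule) _ _ _ _ EIm).
  apply (is_RInt_ext (fun t => comb (Cmult (phi (expi t)) (wplus (w (Cmult (RtoC r) (expi t)))))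
                                   (Cmult (phi (expi t)) (wminus (w (Cmult (RtoC r) (expi t))))))).
  { intros t _; destruct (phi (expi t)) as [c d].
    destruct (w (Cmult (RtoC r) (expi t))) as [[x1 y1] [x2 y2]].
    rewrite wplusE, wminusE; unfold BCinj, RtoC; rewrite BCmultE.
    apply BC_eq; simpl; field. }
  apply (is_RInt_fct_extend_pair (U := C_R_NormedModule) (V := C_R_NormedModule));
    apply (is_RInt_fct_extend_pair (U := R_NormedModule) (V := R_NormedModule)); simpl fst; simpl snd.
  + exact (is_RInt_lin_comb _ _ _ _ _ _ _ _ P1 M1).
  + exact (is_RInt_lin_comb _ _ _ _ _ _ _ _ P2 M2).
  + exact (is_RInt_lin_comb _ _ _ _ _ _ _ _ P2 M2).
  + exact (is_RInt_lin_comb _ _ _ _ _ _ _ _ P1 M1).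
- rewrite Ecomb.
  destruct (filterlim_from_pair (U := R_UniformSpace) (V := R_UniformSpace) _ _ _ Lp) as [P1 P2].
  destruct (filterlim_from_pair (U := R_UniformSpace) (V := R_UniformSpace) _ _ _ Lm) as [M1 M2].
  apply (filterlim_to_pair (U := C_UniformSpace) (V := C_UniformSpace) (at_left 1));
    apply (filterlim_to_pair (U := R_UniformSpace) (V := R_UniformSpace) (at_left 1));
    apply filterlim_lin_comb; try assumption; typeclasses eauto.
Qed.

Lemma is_derive_linear_comp {V : NormedModule R_AbsRing} (L : V -> R) (f : R -> V)
  (x : R) (l : V) :
  is_linear (V := R_NormedModule) L -> is_derive f x l ->
  is_derive (fun t => L (f t)) x (L l).
Proof.
intros HL Hf; unfold is_derive.
apply (filterdiff_ext_lin (V := R_NormedModule) _ (fun u : R_AbsRing => L (scal u l))).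
- apply (filterdiff_comp' (W := R_NormedModule) f L); [exact Hf|].
  now apply filterdiff_linear.
- intros u; apply (linear_scal _ HL).
Qed.

(** The differential of [w] supplies differentiability, and uniqueness of
    partial derivatives identifies its values with [fx] and [fy]. *)
Lemma linear_component_partials (L : BC -> R) (w : C -> BC) (z : C) (fx fy : BC) :
  is_linear (U := BC_NormedModule) (V := R_NormedModule) L ->
  ex_filterdiff (K := R_AbsRing) (U := C_R_NormedModule)
    (V := BC_NormedModule) w (locally (T := C_R_NormedModule) z) ->
  is_derive (V := BC_NormedModule) (fun x : R => w (x, Im z)) (Re z) fx ->
  is_derive (V := BC_NormedModule) (fun y : R => w (Re z, y)) (Im z) fy ->
  differentiable_pt_lim (fun x y => L (w (x, y))) (Re z) (Im z) (L fx) (L fy).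
Proof.
intros HL [l Hw] Hx Hy; destruct z as [x y]; simpl Re in *; simpl Im in *.
assert (HLw : filterdiff (U := C_R_NormedModule) (V := R_NormedModule)
   (fun u : R * R => L (w (fst u, snd u))) (locally (x, y)) (fun u => L (l u))).
{ apply (filterdiff_ext (U := C_R_NormedModule) (V := R_NormedModule) (fun u => L (w u))); [intros [u1 u2]; reflexivity|].
  apply (filterdiff_comp' (U := C_R_NormedModule) (V := BC_NormedModule)
    (W := R_NormedModule) w L); [exact Hw|].
  now apply filterdiff_linear. }
assert (D : differentiable_pt_lim (fun u v => L (w (u, v))) x y (L (l (1, 0))) (L (l (0, 1)))).
{ apply filterdiff_differentiable_pt_lim.
  apply (filterdiff_ext_lin _ _ _ HLw); intros [u1 u2].
  assert (HLl : is_linear (U := C_R_NormedModule) (V := R_NormedModule) (fun u => L (l u))).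
  { exact (proj1 HLw). }
  assert (E : (u1, u2) = @plus C_R_NormedModule (@scal R_AbsRing C_R_NormedModule u1 (1, 0))
     (@scal R_AbsRing C_R_NormedModule u2 (0, 1))).
  { apply injective_projections; unfold plus, scal; simpl; unfold mult, plus, scal; simpl;
    unfold mult; simpl; ring. }
  rewrite E at 1.
  rewrite (linear_plus _ HLl), !(linear_scal _ HLl); reflexivity. }
destruct (differentiable_pt_lim_unique _ _ _ _ _ D) as [E1 E2].
rewrite <- E1, <- E2 in D.
assert (Ex : Derive (fun u => L (w (u, y))) x = L fx).
{ now apply is_derive_unique, (is_derive_linear_comp L (fun u => w (u, y))). }
assert (Ey : Derive (fun v => L (w (x, v))) y = L fy).
{ now apply is_derive_unique, (is_derive_linear_comp L (fun v => w (x, v))). }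
now rewrite <- Ex, <- Ey.
Qed.

Lemma disc_in_C (x y : R) : x ^ 2 + y ^ 2 < 1 -> Cmod (x, y) < 1.
Proof.
intros H; unfold Cmod; simpl fst; simpl snd.
rewrite <- sqrt_1; apply sqrt_lt_1_alt; nra.
Qed.

(** In components, [fx + j fy = 0] says that the second coordinate [z2] of
    [w = z1 + j z2] has partial derivatives [- dz1/dy] and [dz1/dx].  Then
    [z1 + i z2] and the conjugate of [z1 - i z2] satisfy the Cauchy-Riemann
    equations. *)
Lemma bicomplex_CR (w : C -> BC) : dbar_holomorphic w ->
  holo_disc (fun x y => Re (wminus (w (x, y)))) (fun x y => Im (wminus (w (x, y)))) /\
  holo_disc (fun x y => Re (wplus (w (x, y)))) (fun x y => - Im (wplus (w (x, y)))).
Proof.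
intros Hw.
pose (La := fun u : BC => fst (fst u)); pose (Lb := fun u : BC => snd (fst u)).
pose (Lc := fun u : BC => fst (snd u)); pose (Ld := fun u : BC => snd (snd u)).
assert (HLa : is_linear (U := BC_NormedModule) (V := R_NormedModule) La).
{ apply (is_linear_comp (V := C_R_NormedModule) fst fst); apply is_linear_fst. }
assert (HLb : is_linear (U := BC_NormedModule) (V := R_NormedModule) Lb).
{ apply (is_linear_comp (V := C_R_NormedModule) fst snd);
    [apply is_linear_fst|apply is_linear_snd]. }
assert (HLc : is_linear (U := BC_NormedModule) (V := R_NormedModule) Lc).
{ apply (is_linear_comp (V := C_R_NormedModule) snd fst);
    [apply is_linear_snd|apply is_linear_fst]. }
assert (HLd : is_linear (U := BC_NormedModule) (V := R_NormedModule) Ld).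
{ apply (is_linear_comp (V := C_R_NormedModule) snd snd); apply is_linear_snd. }
assert (Hpart : forall x y, x ^ 2 + y ^ 2 < 1 -> exists ax ay bx by_,
  differentiable_pt_lim (fun x y => La (w (x, y))) x y ax ay /\
  differentiable_pt_lim (fun x y => Lb (w (x, y))) x y bx by_ /\
  differentiable_pt_lim (fun x y => Lc (w (x, y))) x y (- ay) ax /\
  differentiable_pt_lim (fun x y => Ld (w (x, y))) x y (- by_) bx).
{ intros x y Hxy; destruct (Hw (x, y) (disc_in_C x y Hxy)) as [Hd [fx [fy [Hx [Hy E]]]]].
  assert (DL := fun L HL => linear_component_partials L w (x, y) fx fy HL Hd Hx Hy).
  assert (Da := DL La HLa); assert (Db := DL Lb HLb).
  assert (Dc := DL Lc HLc); assert (Dd := DL Ld HLd).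
  simpl Re in *; simpl Im in *.
  unfold La, Lb, Lc, Ld in Da, Db, Dc, Dd.
  destruct fx as [[ax bx] [cx dx]], fy as [[ay by_] [cy dy]].
  simpl in Da, Db, Dc, Dd.
  unfold BCinj, BCj, RtoC in E; rewrite BCmultE, BCplusE, BCmultE in E.
  injection E as E1 E2 E3 E4.
  exists ax, ay, bx, by_; repeat split; try assumption.
  - apply (differentiable_pt_lim_eq _ _ _ _ _ _ _ Dc); lra.
  - apply (differentiable_pt_lim_eq _ _ _ _ _ _ _ Dd); lra. }
assert (Hext : forall f f' : R -> R -> R, (forall x y, f x y = f' x y) ->
  forall x y a b a' b', differentiable_pt_lim f x y a b -> a = a' -> b = b' ->
  differentiable_pt_lim f' x y a' b').
{ intros f f' Hff x y a b a' b' D <- <-.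
  apply (differentiable_pt_lim_ext f); [now apply locally_2d_forall|exact D]. }
split; intros x y Hxy; destruct (Hpart x y Hxy) as [ax [ay [bx [by_ [Da [Db [Dc Dd]]]]]]].
- exists (ax + by_), (bx - ay); split.
  + eapply Hext; [|apply (differentiable_pt_lim_plus _ _ _ _ _ _ _ _ Da
      (differentiable_pt_lim_scal (-1) _ _ _ _ _ Dd))|ring|ring].
    intros u v; unfold La, Ld; destruct (w (u, v)) as [[a b] [c d]]; rewrite wminusE; simpl; ring.
  + eapply Hext; [|apply (differentiable_pt_lim_plus _ _ _ _ _ _ _ _ Db Dc)|ring|ring].
    intros u v; unfold Lb, Lc; destruct (w (u, v)) as [[a b] [c d]]; rewrite wminusE; simpl; ring.
- exists (ax - by_), (- ay - bx); split.
  + eapply Hext; [|apply (differentiable_pt_lim_plus _ _ _ _ _ _ _ _ Da Dd)|ring|ring].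
    intros u v; unfold La, Ld; destruct (w (u, v)) as [[a b] [c d]]; rewrite wplusE; simpl; ring.
  + eapply Hext; [|apply (differentiable_pt_lim_plus _ _ _ _ _ _ _ _ Dc
      (differentiable_pt_lim_scal (-1) _ _ _ _ _ Db))|ring|ring].
    intros u v; unfold Lb, Lc; destruct (w (u, v)) as [[a b] [c d]]; rewrite wplusE; simpl; ring.
Qed.

Lemma rpow_le_double (x y p : R) : 0 < p <= 1 -> x <= 2 * y -> rpow x p <= 2 * rpow y p.
Proof.
intros Hp Hxy; unfold rpow; destruct (Rlt_dec 0 x) as [Hx|Hx]; destruct (Rlt_dec 0 y) as [Hy|Hy].
- apply Rle_trans with (Rpower (2 * y) p); [apply Rle_Rpower_l; lra|].
  rewrite <- Rpower_mult_distr by lra; apply Rmult_le_compat_r; [apply Rlt_le, exp_pos|].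
  rewrite <- (Rpower_1 2) at 2 by lra; apply Rle_Rpower; lra.
- exfalso; lra.
- rewrite Rmult_comm; apply Rmult_le_pos; [apply Rlt_le, exp_pos|lra].
- lra.
Qed.

Lemma Cmod_components_le_BCnorm (w : BC) :
  Cmod (wplus w) <= 2 * BCnorm w /\ Cmod (wminus w) <= 2 * BCnorm w.
Proof.
unfold BCnorm; assert (E : 2 = sqrt (2 ^ 2)) by (rewrite sqrt_pow2; lra).
assert (Hp := Cmod_ge_0 (wplus w)); assert (Hm := Cmod_ge_0 (wminus w)).
rewrite E at 1 3; rewrite <- sqrt_mult by nra.
split; [rewrite <- (sqrt_pow2 (Cmod (wplus w))) at 1 by assumption|
        rewrite <- (sqrt_pow2 (Cmod (wminus w))) at 1 by assumption];
  apply sqrt_le_1_alt; nra.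
Qed.

Lemma Hardy_circle_Lp_bound (p : R) (w : C -> BC) (g h : R -> R -> R) :
  0 < p <= 1 -> Hardy p w ->
  (forall x y, modulus g h x y <= 2 * BCnorm (w (x, y))) ->
  exists M, circle_Lp_bound g h p M.
Proof.
intros Hp [_ [M HM]] Hgh; exists (2 * M); intros r Hr.
destruct (HM r Hr) as [I [HI HIM]].
exists (fun t => 2 * rpow (BCnorm (w (Cmult (RtoC r) (expi t)))) p), (2 * I).
split; [now apply (is_RInt_scal (V := R_NormedModule))|split; [lra|]].
intros t; apply rpow_le_double; [exact Hp|]; rewrite Cmult_r_expi; apply Hgh.
Qed.

Lemma Hardy_components_boundary_values (p : R) (w : C -> BC) :
  0 < p <= 1 -> Hardy p w ->
  (exists b, is_boundary_value_C (fun z => wplus (w z)) b) /\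
  (exists b, is_boundary_value_C (fun z => wminus (w z)) b).
Proof.
intros Hp Hw; destruct (bicomplex_CR w (proj1 Hw)) as [Hm Hpl].
split.
- destruct (Hardy_circle_Lp_bound p w (fun x y => Re (wplus (w (x, y))))
    (fun x y => - Im (wplus (w (x, y)))) Hp Hw) as [M HM].
  { intros x y; eapply Rle_trans; [|exact (proj1 (Cmod_components_le_BCnorm (w (x, y))))].
    unfold modulus, Cmod; apply Req_le; f_equal; unfold Re, Im; ring. }
  destruct (holo_Lp_boundary_functional _ _ p M Hpl Hp HM) as [B1 B2].
  eapply complex_boundary_value; [exact B1|].
  intros phi Hphi.
  destruct (is_boundary_functional_opp _ _ B2 phi Hphi) as [E1 E2].
  split.
  + intros r Hr; generalize (E1 r Hr); apply ex_RInt_ext.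
    intros t _; unfold polar; now rewrite Ropp_involutive.
  + revert E2; apply filterlim_ext; intros r; apply RInt_ext.
    intros t _; unfold polar; now rewrite Ropp_involutive.
- destruct (Hardy_circle_Lp_bound p w (fun x y => Re (wminus (w (x, y))))
    (fun x y => Im (wminus (w (x, y)))) Hp Hw) as [M HM].
  { intros x y; eapply Rle_trans; [|exact (proj2 (Cmod_components_le_BCnorm (w (x, y))))].
    apply Rle_refl. }
  destruct (holo_Lp_boundary_functional _ _ p M Hm Hp HM) as [B1 B2].
  exact (complex_boundary_value _ _ _ B1 B2).
Qed.

Theorem proposition6p1 :
  forall (p : R) (w : C -> BC),
    0 < p <= 1 ->
    Hardy p w ->
    exists (wb : (C -> C) -> BC) (wbplus wbminus : (C -> C) -> C),
      is_boundary_value_BC w wb /\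
      is_boundary_value_C (fun z : C => wplus (w z)) wbplus /\
      is_boundary_value_C (fun z : C => wminus (w z)) wbminus /\
      forall phi : C -> C, smooth_circle phi ->
        wb phi = BCplus (BCmult pplus (BCinj (wbplus phi)))
                        (BCmult pminus (BCinj (wbminus phi))).
Proof.
intros p w Hp Hw.
destruct (Hardy_components_boundary_values p w Hp Hw) as [[bp Hbp] [bm Hbm]].
exists (fun phi => BCcomb (bp phi) (bm phi)), bp, bm.
split; [now apply bicomplex_boundary_value|].
split; [exact Hbp|split; [exact Hbm|reflexivity]].
Qed.
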